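(* Let $p\ge 4$ be an even integer and let $X_0$ be a real-valued random variable with $\|X_0\|_p<\infty$ which is measurable with respect to $\mathcal F_0$ and also with respect to $\bar{\mathcal F}_0$. Let $X_i=X_0\circ T^i$, $i\in\mathbb Z$ (setting described in the context). Then there is a constant $C_p$ depending only on $p$ such that for every positive integer $n$, $$ \mathbf E\Bigl(\max_{1\le j\le n}|S_j|^p\Bigr)\le C_p\Biggl[n\,\mathbf E(|X_1|^p)+n\Biggl(\sum_{k=1}^n\frac{1}{k^{1+1/p}}\bigl(\|\mathbf E_0(S_k)\|_p+\|\bar{\mathbf E}_{k+1}(S_k)\|_p\bigr)\Biggr)^p $$ $$ \qquad\qquad+\,n\Biggl(\sum_{k=1}^n\frac{1}{k^{1+2/p}}\bigl(\|\mathbf E_0(S_k^2)\|_{p/2}+\|\bar{\mathbf E}_{k+1}(S_k^2)\|_{p/2}\bigr)\Biggr)^{p/2}\Biggr]. $$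
   Context: Setting: $(\Omega,\mathcal A,\mathbf P)$ is a probability space and $T:\Omega\to\Omega$ is a bijective bi-measurable transformation preserving $\mathbf P$. $\mathcal F_0\subseteq\mathcal A$ is a $\sigma$-algebra with $\mathcal F_0\subseteq T^{-1}(\mathcal F_0)$, and $\mathcal F_i=T^{-i}(\mathcal F_0)$ (a nondecreasing filtration). $\bar{\mathcal F}_0\subseteq\mathcal A$ is a $\sigma$-algebra with $T^{-1}(\bar{\mathcal F}_0)\subseteq\bar{\mathcal F}_0$, and $\bar{\mathcal F}_i=T^{-i}(\bar{\mathcal F}_0)$ (a nonincreasing filtration). Notation: $\mathbf E_k(Y)=\mathbf E(Y\mid\mathcal F_k)$, $\bar{\mathbf E}_k(Y)=\mathbf E(Y\mid\bar{\mathcal F}_k)$, $\|\cdot\|_p$ is the norm in $\mathbf L^p$, $S_n=\sum_{j=1}^nX_j$. The constant $C_p$ does not depend on $n$ nor on the underlying random variables. *)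

(* Defs.v *)
From HB Require Import structures.
From mathcomp Require Import all_boot all_order all_algebra.
From mathcomp Require Import all_classical all_reals all_analysis measurable_realfun.

Set Implicit Arguments.
Unset Strict Implicit.
Unset Printing Implicit Defensive.

Import Order.TTheory GRing.Theory Num.Theory.
Import numFieldNormedType.Exports.

Local Open Scope classical_set_scope.
Local Open Scope ring_scope.

Section conditional_expectation.
Context {d : measure_display} {Omega : measurableType d} {R : realType}.
Implicit Types (P : probability Omega R) (G : set (set Omega)) (Y Z : Omega -> R).

Definition sub_sigma_algebra_of G : Prop :=
  sigma_algebra [set: Omega] G /\ G `<=` measurable.

Definition measurable_wrt G Y : Prop :=
  forall B : set R, measurable B -> G (Y @^-1` B).

Definition is_cond_exp P G Y Z : Prop :=
  [/\ measurable_wrt G Z,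
      P.-integrable [set: Omega] (EFin \o Z) &
      forall A, G A -> (\int[P]_(x in A) (Z x)%:E = \int[P]_(x in A) (Y x)%:E)%E].

(* A chosen version of E(Y | G); it is only meaningful for integrable Y, in
   which case a version exists (cond_expP) and any two versions agree almost
   surely. *)
Definition cond_exp P G Y : Omega -> R := xget (cst 0) (is_cond_exp P G Y).

Lemma cond_exp_exists P G Y : sub_sigma_algebra_of G ->
  P.-integrable [set: Omega] (EFin \o Y) -> exists Z, is_cond_exp P G Y Z.
Proof.
move=> [sG GA] iY.
pose T' : measurableType _ := g_sigma_algebraType G.
have mGE (A : set T') : measurable A = G A.
  by rewrite /measurable/= (sigma_algebra_id sG).
have mid : measurable_fun [set: Omega] (id : Omega -> T').
  by move=> _ A; rewrite mGE => /GA mA; rewrite setTI.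
pose phi : {mfun Omega >-> T'} := mfun_Sub (mem_set mid).
pose mu : probability T' R := distribution P phi.
pose nuf := [the {charge set T' -> \bar R} of
  pushforward (induced_charge iY) (phi : Omega -> T')].
pose nu : {charge set T' -> \bar R} := nuf (measurable_funPT phi).
have nu_mu : nu `<< mu.
  apply/null_content_dominatesP => A mA muA; apply: null_set_integral => //.
  - by apply: GA; rewrite -mGE.
  - have mY := measurable_int _ iY.
    exact: (measurable_funS measurableT (@subsetT _ _) mY).
pose f := Radon_Nikodym nu mu.
have iN : mu.-integrable [set: T'] f by exact: Radon_Nikodym_integrable.
exists (fine \o f).
have ZE : EFin \o (fine \o f) = f.
  by apply/funext => x /=; rewrite fineK// Radon_Nikodym_fin_num.
have mN := measurable_int _ iN.
have mNO : measurable_fun [set: Omega] (f \o phi).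
  exact: (measurableT_comp mN mid).
have iNO : P.-integrable [set: Omega] (f \o phi).
  apply/integrableP; split => //.
  have /integrableP[_] := iN.
  by rewrite /mu/= ge0_integral_pushforward//; apply: measurableT_comp.
split.
- move=> B mB; rewrite -mGE -[X in measurable X]setTI.
  by apply: (measurableT_comp _ mN).
- by rewrite ZE.
- move=> A GA'; rewrite -[LHS]/(\int[P]_(x in A) (EFin \o (fine \o f)) x)%E ZE.
  have mA : measurable (A : set T') by rewrite mGE.
  have := Radon_Nikodym_integral nu_mu mA.
  rewrite {1}/nu/= /pushforward /induced_charge /= => ->.
  rewrite /mu integral_pushforward//.
  by apply: (integrableS measurableT _ _ iNO) => //; exact: GA.
Qed.

Lemma cond_expP P G Y : sub_sigma_algebra_of G ->
  P.-integrable [set: Omega] (EFin \o Y) -> is_cond_exp P G Y (cond_exp P G Y).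
Proof. by move=> sG iY; apply: xgetPex; exact: cond_exp_exists. Qed.

End conditional_expectation.

Section stationary_process.
Context {Omega : Type} {R : realType}.
Variables T Tinv : Omega -> Omega.

(* T^i for i in Z, where Tinv is meant to be the inverse of T. *)
Definition iterz (i : int) : Omega -> Omega :=
  match i with Posz n => iter n T | Negz n => iter n.+1 Tinv end.

(* The system T^{-i}(G) of the preimages of the members of G under T^i. *)
Definition shifted_algebra (G : set (set Omega)) (i : int) : set (set Omega) :=
  preimage_set_system [set: Omega] (iterz i) G.

Definition process (X0 : Omega -> R) (i : int) : Omega -> R := X0 \o iterz i.

Definition partial_sum (X0 : Omega -> R) (n : nat) : Omega -> R :=
  fun x => \sum_(1 <= j < n.+1) process X0 j%:Z x.

End stationary_process.

(* Main.v *)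
(* The L^p norm of E(Y | G) is only used through its dual description: it bounds
   |E(A Y)| by a multiple of the L^q norm of A for every nonnegative G-measurable
   A, with 1/p + 1/q = 1. Such bounds are stable under splitting
   S_(i+j) = S_i + S_j o T^i, so a bound at time 2^k follows by averaging from
   the bounds at all times j < 2^k; this turns dyadic sums into the sums over k
   of the theorem.

   Moments: with f = S_n and g = S_n o T^n, expand (f + g)^p for even p. The
   terms f^(p-1) g and f^(p-2) g^2 are controlled by the filtration F, the terms
   f g^(p-1) and f^2 g^(p-2) by the filtration Fbar, and all others by these.
   Hence a_(2n)^p <= 2 a_n^p + c a_n^(p-1) e_n + c a_n^(p-2) v_n for the norms
   a_n of S_n, and the recursion for 2^(-k/p) a_(2^k) is solved at the index
   where it is maximal.

   Maximum: let M_k = max(0, S_1, ..., S_k) and A_k = M_k^(p-1). Since M_k = S_k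
   whenever M increases,
     M_n^p <= 2 sum_k (A_k - A_(k-1)) S_k = 2 (A_n S_n - sum_(j<n) A_j X_(j+1)).
   For nondecreasing adapted A, E(sum_(j<2^r) A_j X_(j+1)) is bounded by
   induction on r: on the second half of the time interval, A is replaced by its
   increment from the midpoint, and
   |a|_q + |b|_q <= 2^(1/p) |a + b|_q for a, b >= 0 recombines the two halves.
   No maximal inequality for martingales is needed. *)
Require Import Defs.
From HB Require Import structures.
From mathcomp Require Import all_boot all_order all_algebra.
From mathcomp Require Import all_classical all_reals all_analysis measurable_realfun.
From mathcomp Require Import finmap zify ring lra.
Import Order.TTheory GRing.Theory Num.Theory.
Import numFieldNormedType.Exports.
Local Open Scope classical_set_scope.
Local Open Scope ring_scope.

(** * Conditional expectations as dual bounds *)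

Section test_functions.
Import HBNNSimple.
Context {d : measure_display} {Omega : measurableType d} {R : realType}.
Variable P : probability Omega R.

(** The defining identity on members of [G] extends to simple [G]-measurable functions by linearity.
    The simple approximants h_n of A satisfy 0 <= h_n <= A, so |A W| dominates h_n W for W = Y and W
    = Z, and dominated convergence concludes. *)
Lemma cond_exp_test (G : set (set Omega)) (Y Z A : Omega -> R) :
  sub_sigma_algebra_of G -> is_cond_exp P G Y Z ->
  P.-integrable setT (EFin \o Y) ->
  (forall x, 0 <= A x) -> measurable_wrt G A ->
  P.-integrable setT (EFin \o (A \* Y)) -> P.-integrable setT (EFin \o (A \* Z)) ->
  (\int[P]_x (A x * Y x)%:E = \int[P]_x (A x * Z x)%:E)%E.
Proof.
move=> [sG GA] [mZ iZ EZ] iY A0 mA iAY iAZ.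
pose T' : measurableType _ := g_sigma_algebraType G.
have mGE (B : set T') : measurable B = G B.
  by rewrite /measurable/= (sigma_algebra_id sG).
have mA' : measurable_fun [set: T'] (EFin \o (A : T' -> R)).
  by apply/measurable_EFinP => _ B mB; rewrite setTI mGE; exact: mA.
(* The approximation is carried out over [T'], whose measurable sets are those of [G]; the level
   sets of [h n] therefore belong to [G]. *)
pose h := nnsfun_approx measurableT mA'.
have hA (x : T') : (h n x)%:E @[n --> \oo] --> (A x)%:E.
  apply: (@cvg_nnsfun_approx _ T' R setT measurableT _ mA') => //.
  by move=> y _; rewrite lee_fin.
have h_le n (x : T') : 0 <= h n x <= A x.
  rewrite fun_ge0/= -lee_fin.
  have nd : nondecreasing_seq (fun n => (h n x)%:E).
    move=> i j ij; rewrite lee_fin.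
    by have /lefP := nd_nnsfun_approx measurableT mA' ij.
  rewrite (cvg_unique _ (hA x) (ereal_nondecreasing_cvgn nd))//.
  by apply: ereal_sup_ubound; exists n.
have mh n r : G (h n @^-1` [set r]) by rewrite -mGE; apply: measurable_funPTI.
have mhO n : measurable_fun setT (h n : Omega -> R).
  move=> _ B mB; rewrite setTI; apply: GA; rewrite -mGE.
  by apply: (measurable_funPTI (h n)).
have hE n (W : Omega -> R) : P.-integrable setT (EFin \o W) ->
  (\int[P]_x (h n x * W x)%:E =
   \sum_(r <- fset_set (range (h n)))
     r%:E * \int[P]_(x in h n @^-1` [set r]) (W x)%:E)%E.
  move=> iW.
  have hW x : ((h n x * W x)%:E = \sum_(r <- fset_set (range (h n)))
      r%:E * ((EFin \o W) \_ (h n @^-1` [set r])) x)%E.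
    rewrite (fimfunE (h n)) fsbig_finite// mulr_suml -sumEFin.
    apply: eq_bigr => r _; rewrite -mulrA EFinM; congr (_ * _)%E.
    rewrite patchE indicE; case: ifPn => _; first by rewrite mul1r.
    by rewrite mul0r.
  have iWr r : P.-integrable setT ((EFin \o W) \_ (h n @^-1` [set r])).
    apply/(integrable_mkcond _ (GA _ (mh n r))).
    by apply: (integrableS measurableT _ _ iW) => //; exact: GA.
  under eq_integral do rewrite hW.
  rewrite integral_sum//; last by move=> r; apply: integrableZl.
  apply: eq_bigr => r _; rewrite integralZl//; congr (_ * _)%E.
  by rewrite [RHS]integral_mkcond.
have lim (W : Omega -> R) : P.-integrable setT (EFin \o (A \* W)) ->
   P.-integrable setT (EFin \o W) ->
   (\int[P]_x (h n x * W x)%:E)%E @[n --> \oo] --> (\int[P]_x (A x * W x)%:E)%E.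
  move=> iAW iW.
  have mW := measurable_int _ iW.
  have [] := @dominated_convergence _ Omega R P setT measurableT
     (fun n x => (h n x * W x)%:E) (fun x => (A x * W x)%:E)
     (fun x => `|(A x * W x)%:E|)%E.
  - move=> n; apply/measurable_EFinP; apply: measurable_funM => //.
    exact/measurable_EFinP.
  - exact: measurable_int iAW.
  - apply: aeW => x _.
    have AWdef : ((A x)%:E *? (W x)%:E)%E by rewrite mule_def_fin.
    exact: (cvgeM AWdef (hA x) (cvg_cst (W x)%:E)).
  - exact: integrable_abse.
  - apply: aeW => x n _; rewrite !abse_EFin lee_fin !normrM ler_wpM2r//.
    by have /andP[h0 hA'] := h_le n x; rewrite !ger0_norm.
  by [].
apply: (cvg_unique _ (lim Y iAY iY)) => //.
have -> : (fun n => (\int[P]_x (h n x * Y x)%:E)%E) =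
          (fun n => (\int[P]_x (h n x * Z x)%:E)%E).
  apply/funext => n; rewrite !hE//; apply: eq_bigr => r _; congr (_ * _)%E.
  by rewrite EZ.
exact: lim.
Qed.
End test_functions.

(** * Real-valued L^r norms, Hoelder's inequality and dual bounds *)

Section Lr.
Context {d : measure_display} {Omega : measurableType d} {R : realType}.
Variable P : probability Omega R.
Implicit Types (f g : Omega -> R) (r p q : R).

(** [fine] sends an infinite norm to 0, so the value is meaningful only for f in [Lfun P r%:E]. *)
Definition nrm r f : R := fine ('N[P]_(r%:E)[EFin \o f])%E.

Lemma Lr_measurable {r f} : f \in Lfun P r%:E -> measurable_fun setT f.
Proof. by move=> /andP[/set_mem]. Qed.

Lemma nrm_ge0 r f : 0 <= nrm r f.
Proof. by rewrite fine_ge0// Lnorm_ge0. Qed.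

Lemma nrmE {r f} : f \in Lfun P r%:E -> ('N[P]_(r%:E)[EFin \o f] = (nrm r f)%:E)%E.
Proof.
move=> /andP[_ /set_mem fN].
by rewrite fineK// ge0_fin_numE// Lnorm_ge0.
Qed.

Lemma Lr_le r f g : 0 < r -> measurable_fun setT f -> (forall x, `|f x| <= `|g x|) ->
  g \in Lfun P r%:E -> f \in Lfun P r%:E /\ nrm r f <= nrm r g.
Proof.
move=> r0 mf fg gL; have mg := Lr_measurable gL.
have le : ('N[P]_(r%:E)[EFin \o f] <= 'N[P]_(r%:E)[EFin \o g])%E.
  rewrite unlock; apply: gt0_ler_poweR; first by rewrite invr_ge0 ltW.
  - by rewrite in_itv/= leey andbT integral_ge0.
  - by rewrite in_itv/= leey andbT integral_ge0.
  have mpow (h : Omega -> R) : measurable_fun setT h ->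
      measurable_fun setT (fun x => (`|h x| `^ r)%:E).
    move=> mh; apply/measurable_EFinP.
    apply: (measurableT_comp (measurable_powR _)) => //.
    exact: measurableT_comp.
  apply: ge0_le_integral => //.
  - by move=> x _; rewrite poweR_ge0.
  - exact: mpow mf.
  - exact: mpow mg.
  by move=> x _ /=; rewrite lee_fin ge0_ler_powR ?nnegrE// ltW.
have fL : f \in Lfun P r%:E.
  apply/andP; split; apply: mem_set => //; rewrite /finite_norm/=.
  by rewrite (le_lt_trans le)// (nrmE gL) ltry.
by split => //; rewrite -lee_fin -!nrmE.
Qed.

Lemma LrD r f g : 1 <= r -> f \in Lfun P r%:E -> g \in Lfun P r%:E ->
  (fun x => f x + g x) \in Lfun P r%:E.
Proof.
move=> r1; have r1' : (1 <= r%:E)%E by rewrite lee_fin.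
exact: (Lfun_addr_closed P r1').2.
Qed.

Lemma nrm_powR {r f} : 0 < r -> f \in Lfun P r%:E ->
  (\int[P]_x (`|f x| `^ r)%:E = (nrm r f `^ r)%:E)%E.
Proof.
by move=> r0 /nrmE fE; rewrite -poweR_EFin -fE powR_Lnorm ?gt_eqF.
Qed.

Lemma Lr_integrable {r f} : 0 < r -> f \in Lfun P r%:E ->
  P.-integrable setT (EFin \o (fun x => `|f x| `^ r)).
Proof.
move=> r0 fL; have mf := Lr_measurable fL.
apply/integrableP; split.
  apply/measurable_EFinP; apply: (measurableT_comp (measurable_powR _)) => //.
  exact: measurableT_comp.
under eq_integral do rewrite gee0_abs ?lee_fin ?powR_ge0//.
by rewrite (nrm_powR r0 fL) ltry.
Qed.

Lemma integrable_Lr r f : 0 < r -> measurable_fun setT f ->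
  P.-integrable setT (EFin \o (fun x => `|f x| `^ r)) -> f \in Lfun P r%:E.
Proof.
move=> r0 mf /integrableP[_ fi]; apply/andP; split; apply: mem_set => //.
rewrite /finite_norm/= unlock poweR_lty//; apply: le_lt_trans fi.
rewrite le_eqVlt; apply/orP; left; apply/eqP.
by apply: eq_integral => x _; rewrite [RHS]gee0_abs ?lee_fin ?powR_ge0.
Qed.

Lemma hoelder_Lr {p q f g} : 0 < p -> 0 < q -> p^-1 + q^-1 = 1 ->
  f \in Lfun P p%:E -> g \in Lfun P q%:E ->
  P.-integrable setT (EFin \o (f \* g)) /\
  `|\int[P]_x (f x * g x)| <= nrm p f * nrm q g.
Proof.
move=> p0 q0 pq fL gL; have mf := Lr_measurable fL; have mg := Lr_measurable gL.
have := hoelder P mf mg p0 q0 pq; rewrite (nrmE fL) (nrmE gL) -EFinM => le.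
have fg1 : f \* g \in Lfun P 1.
  apply/andP; split; apply: mem_set; first exact: measurable_funM.
  by rewrite /finite_norm/= (le_lt_trans le)// ltry.
have ifg := (Lfun1_integrable P _).1 fg1; split => //.
apply: le_trans (le_normr_Rintegral _ ifg) _ => //.
rewrite -lee_fin (le_trans _ le)// Lnorm1 /Rintegral fineK//.
by apply: integrable_fin_num => //; exact: integrable_abse ifg.
Qed.

(** Hoelder's inequality against the constant 1, which lies in every L^q of a probability space. *)
Lemma Lr_integrable1 {p f} : 1 < p -> f \in Lfun P p%:E ->
  P.-integrable setT (EFin \o f).
Proof.
move=> p1 fL; have p0 : 0 < p by rewrite (lt_trans _ p1).
have q0 : 0 < (1 - p^-1)^-1 by rewrite invr_gt0 subr_gt0 invf_lt1.
have [] := @hoelder_Lr p (1 - p^-1)^-1 f (cst 1) p0 q0 _ fL (Lfun_cst _ _ _).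
  by rewrite invrK; ring.
move=> /= + _; rewrite [X in _.-integrable _ (_ \o X)](_ : _ = f)//.
by apply/funext => x /=; rewrite mulr1.
Qed.

(** For k = p - 1 and k = p - 2 the exponent p / k is conjugate to p and to p / 2 respectively, so
    |f|^k becomes a test function for dual bounds at these exponents; k = 2 puts squares into
    L^(p/2). *)
Lemma Lr_pow (k : nat) p f : (0 < k)%N -> 0 < p -> f \in Lfun P p%:E ->
  (fun x => `|f x| ^+ k) \in Lfun P (p / k%:R)%:E /\
  nrm (p / k%:R) (fun x => `|f x| ^+ k) = nrm p f ^+ k.
Proof.
move=> k0 p0 fL; have mf := Lr_measurable fL.
have k0R : (0 : R) < k%:R by rewrite ltr0n.
have pk0 : 0 < p / k%:R by rewrite divr_gt0.
have E x : `| `|f x| ^+ k| `^ (p / k%:R) = `|f x| `^ p.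
  by rewrite ger0_norm ?exprn_ge0// -powR_mulrn// -powRrM mulrCA divff ?gt_eqF// mulr1.
have kL : (fun x => `|f x| ^+ k) \in Lfun P (p / k%:R)%:E.
  apply: integrable_Lr => //.
    by apply: measurable_funX; exact: measurableT_comp.
  rewrite [X in EFin \o X](_ : _ = fun x => `|f x| `^ p); last first.
    by apply/funext => x; exact: E.
  exact: Lr_integrable.
split => //.
have := nrm_powR pk0 kL; under eq_integral do rewrite E.
rewrite (nrm_powR p0 fL) => -[] eq.
apply: (powR_injective pk0); rewrite ?nnegrE ?nrm_ge0 ?exprn_ge0 ?nrm_ge0//.
by rewrite -eq -powR_mulrn ?nrm_ge0// -powRrM mulrCA divff ?gt_eqF// mulr1.
Qed.

(* With [cls] the class of G-measurable functions, the least [c] is, up to a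
   factor 2 due to the restriction to nonnegative [A], the L^p norm of
   E(Y | G), where p is conjugate to q. *)
Definition dual_bound (cls : (Omega -> R) -> Prop) q (Y : Omega -> R) (c : R) :=
  forall A : Omega -> R, (forall x, 0 <= A x) -> cls A ->
    A \in Lfun P q%:E -> `|\int[P]_x (A x * Y x)| <= c * nrm q A.

(** Testing against a [G]-measurable A replaces Y by its conditional expectation; Hoelder's
    inequality then gives the bound with the norm of the latter. *)
Lemma dual_bound_cond_exp (G : set (set Omega)) p q (Y : Omega -> R) :
  0 < p -> 0 < q -> p^-1 + q^-1 = 1 ->
  sub_sigma_algebra_of G -> Y \in Lfun P p%:E ->
  exists c, [/\ 0 <= c, (c%:E <= 'N[P]_(p%:E)[EFin \o cond_exp P G Y])%E &
    dual_bound (measurable_wrt G) q Y c].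
Proof.
move=> p0 q0 pq sG YL.
have p1 : 1 < p.
  by rewrite -invf_lt1// -pq ltrDl invr_gt0.
have qp : q^-1 + p^-1 = 1 by rewrite addrC.
have iY := Lr_integrable1 p1 YL.
have := cond_expP sG iY; set Z := cond_exp P G Y => ZP.
(* An infinite norm exceeds every constant; in that case c = ||Y||_p serves, by Hoelder's inequality
   applied to Y itself. *)
have [|Noo] := eqVneq ('N[P]_(p%:E)[EFin \o Z])%E +oo%E.
  move=> ->; exists (nrm p Y); split; rewrite ?nrm_ge0 ?leey// => A A0 mA AL.
  by have [_] := hoelder_Lr q0 p0 qp AL YL; rewrite mulrC.
have ZL : Z \in Lfun P p%:E.
  case: ZP => _ iZ _; apply/andP; split; apply: mem_set.
    by apply/measurable_EFinP; exact: measurable_int iZ.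
  by rewrite /finite_norm/= ltey.
exists (nrm p Z); split; rewrite ?nrm_ge0 ?(nrmE ZL)// => A A0 mA AL.
have [iAY _] := hoelder_Lr q0 p0 qp AL YL.
have [iAZ] := hoelder_Lr q0 p0 qp AL ZL.
by rewrite mulrC /Rintegral (cond_exp_test _ _ _ _ _ sG ZP).
Qed.

End Lr.

Lemma iter_cancel {T : Type} {f g : T -> T} : cancel f g ->
  forall n, cancel (iter n f) (iter n g).
Proof. by move=> fg; elim=> [|n ih] x //=; rewrite -iterS iterSr fg ih. Qed.

(** * Measurability with respect to a sub-sigma-algebra *)

Section measurable_wrt.
Context {d : measure_display} {Omega : measurableType d} {R : realType}.
Variable G : set (set Omega).
Hypothesis G_sub : sub_sigma_algebra_of G.
Implicit Types f g : Omega -> R.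

(** Passing to the space equipped with [G] turns the closure properties of measurable functions into
    closure properties of [measurable_wrt]. *)
Lemma measurable_wrtE f : measurable_wrt G f <->
  measurable_fun [set: g_sigma_algebraType G] (f : g_sigma_algebraType G -> R).
Proof.
have mGE (B : set (g_sigma_algebraType G)) : measurable B = G B.
  by rewrite /measurable/= (sigma_algebra_id G_sub.1).
split=> mf; first by move=> _ B mB; rewrite setTI mGE; exact: mf.
by move=> B mB; rewrite -mGE -[_ @^-1` _]setTI; exact: mf.
Qed.

Lemma measurable_wrt_cst (c : R) : measurable_wrt G (cst c : Omega -> R).
Proof. by apply/measurable_wrtE. Qed.

Lemma measurable_wrtD f g : measurable_wrt G f -> measurable_wrt G g ->
  measurable_wrt G (fun x => f x + g x).
Proof.
by move=> /measurable_wrtE mf /measurable_wrtE mg; apply/measurable_wrtE/measurable_funD.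
Qed.

Lemma measurable_wrt_max f g : measurable_wrt G f -> measurable_wrt G g ->
  measurable_wrt G (fun x => Num.max (f x) (g x)).
Proof.
by move=> /measurable_wrtE mf /measurable_wrtE mg; apply/measurable_wrtE/measurable_maxr.
Qed.

Lemma measurable_wrt_comp (h : R -> R) f : measurable_fun setT h ->
  measurable_wrt G f -> measurable_wrt G (h \o f).
Proof.
by move=> mh /measurable_wrtE mf; apply/measurable_wrtE/measurableT_comp.
Qed.

End measurable_wrt.

(** * Invariance of integrals, norms and dual bounds under the shift *)

Section shift.
Context {d : measure_display} {Omega : measurableType d} {R : realType}.
Context {P : probability Omega R} {T Tinv : Omega -> Omega}.
Hypothesis mT : measurable_fun [set: Omega] T.
Hypothesis mTinv : measurable_fun [set: Omega] Tinv.
Hypothesis TK : cancel T Tinv.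
Hypothesis TinvK : cancel Tinv T.
Hypothesis TP : forall A : set Omega, measurable A -> P (T @^-1` A) = P A.

Lemma measurable_iter m (f : Omega -> Omega) : measurable_fun setT f ->
  measurable_fun setT (iter m f).
Proof.
move=> mf; elim: m => [|m ih]; first exact: measurable_id.
exact: (measurableT_comp mf ih).
Qed.

Lemma measurable_iterT m {f : Omega -> R} : measurable_fun setT f ->
  measurable_fun setT (fun x => f (iter m T x)).
Proof. by move=> mf; apply: (measurableT_comp mf); exact: measurable_iter. Qed.

Lemma measurable_iterTinv m {f : Omega -> R} : measurable_fun setT f ->
  measurable_fun setT (fun x => f (iter m Tinv x)).
Proof. by move=> mf; apply: (measurableT_comp mf); exact: measurable_iter. Qed.

(** Change of variables: the image measure of P under T is P itself. *)
Lemma ge0_integral_T (f : Omega -> \bar R) : measurable_fun setT f ->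
  (forall x, 0 <= f x)%E -> (\int[P]_x f (T x) = \int[P]_x f x)%E.
Proof.
move=> mf f0.
pose phi : {mfun Omega >-> Omega} := mfun_Sub (mem_set mT).
have := ge0_integral_pushforward mT P measurableT mf (fun x _ => f0 x).
rewrite preimage_setT => <-.
by apply: (eq_measure_integral P (m1 := pushforward P phi)) => A mA _; exact: TP.
Qed.

Lemma integral_iterT m {f : Omega -> R} : measurable_fun setT f ->
  (\int[P]_x (f (iter m T x))%:E = \int[P]_x (f x)%:E)%E.
Proof.
move=> mf; elim: m => [//|m <-]; under eq_integral do rewrite iterSr.
have mg : measurable_fun setT (EFin \o (fun x => f (iter m T x))).
  by apply/measurable_EFinP; exact: measurable_iterT.
set g := EFin \o _ in mg; rewrite -[LHS]/(\int[P]_x (g \o T) x)%E.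
rewrite [LHS]integralE [RHS]integralE funepos_comp funeneg_comp.
rewrite -(ge0_integral_T _ (measurable_funepos mg)); last exact: funepos_ge0.
by rewrite -(ge0_integral_T _ (measurable_funeneg mg))//; exact: funeneg_ge0.
Qed.

Lemma Rintegral_iterT m {f : Omega -> R} : measurable_fun setT f ->
  \int[P]_x (f (iter m T x)) = \int[P]_x (f x).
Proof. by move=> mf; rewrite /Rintegral integral_iterT. Qed.

Lemma Lr_iterT {r} m {f : Omega -> R} : f \in Lfun P r%:E ->
  (fun x => f (iter m T x)) \in Lfun P r%:E /\
  nrm P r (fun x => f (iter m T x)) = nrm P r f.
Proof.
move=> fL; have mf := Lr_measurable P fL.
have E : ('N[P]_(r%:E)[EFin \o (fun x => f (iter m T x))] = 'N[P]_(r%:E)[EFin \o f])%E.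
  rewrite unlock; apply: (congr1 (fun z => poweR z _)).
  apply: (@integral_iterT m (fun x => `|f x| `^ r)).
  apply: (measurableT_comp (measurable_powR _)) => //; exact: measurableT_comp.
split; last by rewrite /nrm E.
apply/andP; split; apply: mem_set => /=; first exact: measurable_iterT.
by rewrite /finite_norm E (nrmE P fL) ltry.
Qed.

Lemma Rintegral_iterTinv m {A Y : Omega -> R} :
  measurable_fun setT A -> measurable_fun setT Y ->
  \int[P]_x (A x * Y (iter m T x)) = \int[P]_x (A (iter m Tinv x) * Y x).
Proof.
move=> mA mY.
have mAY : measurable_fun setT (fun x => A (iter m Tinv x) * Y x).
  by apply: measurable_funM => //; exact: measurable_iterTinv.
rewrite -(Rintegral_iterT m mAY).
by apply: eq_Rintegral => x _; rewrite (iter_cancel TK).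
Qed.

Lemma Lr_iterTinv {r} m {f : Omega -> R} : f \in Lfun P r%:E ->
  (fun x => f (iter m Tinv x)) \in Lfun P r%:E /\
  nrm P r (fun x => f (iter m Tinv x)) = nrm P r f.
Proof.
move=> fL; have mf := Lr_measurable P fL.
have E : ('N[P]_(r%:E)[EFin \o (fun x => f (iter m Tinv x))] = 'N[P]_(r%:E)[EFin \o f])%E.
  rewrite unlock; apply: (congr1 (fun z => poweR z _)).
  have mg : measurable_fun setT (fun x => `|f (iter m Tinv x)| `^ r).
    apply: (measurableT_comp (measurable_powR _)) => //.
    by apply: measurableT_comp => //; exact: measurable_iterTinv.
  rewrite -[LHS](integral_iterT m mg).
  by apply: eq_integral => x _; rewrite (iter_cancel TK).
split; last by rewrite /nrm E.
apply/andP; split; apply: mem_set => /=; first exact: measurable_iterTinv.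
by rewrite /finite_norm E (nrmE P fL) ltry.
Qed.

(** By invariance E(A (Y o T^m)) = E((A o T^-m) Y), and A o T^-m has the same L^q norm as A. The
    class of test functions is transported accordingly. *)
Lemma dual_bound_iter {cls : (Omega -> R) -> Prop} {q c Y} m :
  measurable_fun setT Y -> dual_bound P cls q Y c ->
  dual_bound P (fun A => cls (fun x => A (iter m Tinv x))) q (fun x => Y (iter m T x)) c.
Proof.
move=> mY cY A A0 clsA AL; have mA := Lr_measurable P AL.
have [AL' <-] := Lr_iterTinv m AL.
by rewrite Rintegral_iterTinv//; exact: cY.
Qed.

End shift.

(** * Averaging dual bounds over the splittings of a time interval *)

Section averaging.
Context {d : measure_display} {Omega : measurableType d} {R : realType}.
Context {P : probability Omega R} {T Tinv : Omega -> Omega}.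
Hypothesis mT : measurable_fun [set: Omega] T.
Hypothesis mTinv : measurable_fun [set: Omega] Tinv.
Hypothesis TK : cancel T Tinv.
Hypothesis TP : forall A : set Omega, measurable A -> P (T @^-1` A) = P A.

(* Summing the bounds obtained from the splittings N = j + (N - j), 0 < j < N. *)
Lemma dual_bound_average {cls : nat -> (Omega -> R) -> Prop} {Y : nat -> Omega -> R}
    {e : nat -> R} {q K : R} :
  0 <= K -> (forall n, 0 <= e n) -> (forall n, measurable_fun setT (Y n)) ->
  (forall i j A, cls (i + j)%N A -> cls i A) ->
  (forall i j A, cls (i + j)%N A -> cls j (fun x => A (iter i Tinv x))) ->
  (forall i j A, (forall x, 0 <= A x) -> A \in Lfun P q%:E ->
    `|\int[P]_x (A x * Y (i + j)%N x)| <=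
    K * (`|\int[P]_x (A x * Y i x)| + `|\int[P]_x (A x * Y j (iter i T x))|)) ->
  (forall n, (0 < n)%N -> dual_bound P (cls n) q (Y n) (e n)) ->
  forall N, (1 < N)%N ->
  dual_bound P (cls N) q (Y N) (4 * K / N%:R * \sum_(1 <= j < N) e j).
Proof.
move=> K0 e0 mY clsl clsr sub eY N N1 A A0 clsA AL.
set I := `|_|; set E := \sum_(_ <= _ < _) _.
have E0 : 0 <= E by apply: sumr_ge0.
have nA0 : 0 <= nrm P q A by exact: nrm_ge0.
(* There are N - 1 splittings. The reflection j -> N - j shows that both pieces contribute the same
   sum, whence one factor 2; the other factor 2 of the constant 4 comes from N <= 2 (N - 1). *)
have : (N.-1)%:R * I <= K * nrm P q A * (2 * E).
  have -> : (N.-1)%:R * I = \sum_(1 <= j < N) I.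
    by rewrite sumr_const_nat subn1 mulr_natl.
  have -> : 2 * E = \sum_(1 <= j < N) (e j + e (N - j)%N).
    rewrite big_split/= mulr_natl mulr2n; congr (_ + _).
    by rewrite /E big_nat_rev/=; apply: eq_bigr => j _; congr e; lia.
  rewrite mulr_sumr !big_nat; apply: ler_sum => j /andP[j1 jN].
  have NE : (j + (N - j))%N = N by lia.
  have := sub j (N - j)%N A A0 AL; rewrite NE => /le_trans; apply.
  rewrite -mulrA ler_wpM2l// mulrC mulrDl lerD//.
    by apply: eY => //; apply: (clsl _ (N - j)%N); rewrite NE.
  apply: (dual_bound_iter mT mTinv TK TP j (mY (N - j)%N) (eY (N - j)%N _)) => //.
    by lia.
  by apply: clsr; rewrite NE.
have N0 : (0 : R) < N%:R by rewrite ltr0n; lia.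
have NN : (N%:R : R) <= 2 * (N.-1)%:R by rewrite -natrM ler_nat; lia.
have I0 : 0 <= I by exact: normr_ge0.
move=> H; have -> : 4 * K / N%:R * E * nrm P q A = 2 * (K * nrm P q A * (2 * E)) / N%:R.
  by ring.
rewrite ler_pdivlMr// mulrC (@le_trans _ _ (2 * (N.-1)%:R * I))//.
  by rewrite ler_wpM2r.
by rewrite -mulrA ler_wpM2l.
Qed.

End averaging.

(** * Functions adapted to the shifted sigma-algebras *)

Section adapted.
Context {d : measure_display} {Omega : measurableType d} {R : realType}.
Variables (T Tinv : Omega -> Omega) (G : set (set Omega)).
Hypothesis TK : cancel T Tinv.
Hypothesis TinvK : cancel Tinv T.

(* The functions measurable with respect to T^{-m}(G). *)
Definition adapted m (A : Omega -> R) : Prop :=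
  measurable_wrt G (fun x => A (iter m Tinv x)).

Lemma adapted_shift i j (A : Omega -> R) :
  adapted (i + j) A <-> adapted j (fun x => A (iter i Tinv x)).
Proof. by rewrite /adapted; under eq_fun do rewrite iterD. Qed.

Lemma adapted_iterT i j (A : Omega -> R) :
  adapted j A -> adapted (i + j) (fun x => A (iter i T x)).
Proof.
move=> Aj; apply/adapted_shift; rewrite (_ : (fun x => _) = A)//.
by apply/funext => x; rewrite (iter_cancel TinvK).
Qed.

Lemma adapted_shifted_algebra m (A : Omega -> R) : adapted m A ->
  measurable_wrt (shifted_algebra T Tinv G m%:Z) A.
Proof.
move=> mA B mB; exists ((fun x => A (iter m Tinv x)) @^-1` B); first exact: mA.
by rewrite setTI; apply/seteqP; split => x /=; rewrite (iter_cancel TK).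
Qed.

End adapted.

(** * Dyadic sums and the moment recursion *)

Section numeric.
Context {R : realType}.

(* [dyadic_average K e k] dominates a bound at time [2 ^ k] by bounds at all
   smaller times, so dyadic sums reduce to full sums although [e] need not be
   monotone. *)
Definition dyadic_average (K : R) (e : nat -> R) k : R :=
  if k is 0%N then e 1%N else 4 * K / (2 ^ k)%:R * \sum_(1 <= j < 2 ^ k) e j.

Lemma dyadic_average_ge0 K e k : 0 <= K -> (forall j, 0 <= e j) ->
  0 <= dyadic_average K e k.
Proof.
move=> K0 e0; case: k => [|k]; rewrite /dyadic_average//.
by rewrite mulr_ge0 ?sumr_ge0// divr_ge0// ?mulr_ge0.
Qed.

Lemma powR_inv2n (al : R) k : (2 `^ (- al)) ^+ k = ((2 ^ k)%:R `^ al)^-1.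
Proof.
by rewrite -powR_mulrn ?powR_ge0// natrX -powR_mulrn// -!powRrM -powRN; congr (_ `^ _); ring.
Qed.

(** Interchanging the sums, e_j collects the weights w_k = 2^(-k (1 + al)) of all k with 2^k > j,
    where the additional 1 in the exponent is the denominator 2^k of the average. These weights at
    least halve at each step, so they add up to at most twice the first one, which is at most j^(-(1
    + al)). The 1 in 1 + 8 K accounts for k = 0, and 8 = 4 * 2. *)
Lemma sum_dyadic_average (K al : R) (e : nat -> R) r n : 0 <= K -> 0 <= al ->
  (forall j, 0 <= e j) -> (0 < n)%N -> (2 ^ r <= n)%N ->
  \sum_(k < r) (2 `^ (- al)) ^+ k * dyadic_average K e k <=
  (1 + 8 * K) * \sum_(1 <= j < n.+1) (j%:R `^ (1 + al))^-1 * e j.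
Proof.
move=> K0 al0 e0 n0 rn.
pose w k : R := ((2 ^ k)%:R `^ (1 + al))^-1.
pose E k : R := \sum_(1 <= j < 2 ^ k) e j.
pose W k : R := \sum_(1 <= j < 2 ^ k) (j%:R `^ (1 + al))^-1 * e j.
have w0 k : 0 <= w k by rewrite invr_ge0 powR_ge0.
have wS k : 2 * w k.+1 <= w k.
  rewrite /w -!powR_inv2n exprS mulrA ler_piMl ?exprn_ge0 ?powR_ge0//.
  by rewrite powRN -ler_pdivlMr ?invr_gt0 ?powR_gt0// invrK mul1r le1r_powR//; lra.
have EW k : E k.+1 = E k + \sum_(2 ^ k <= j < 2 ^ k.+1) e j.
  by rewrite /E -big_cat_nat//= ?expn_gt0// leq_exp2l.
have WS k : W k + w k.+1 * \sum_(2 ^ k <= j < 2 ^ k.+1) e j <= W k.+1.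
  rewrite (_ : W k.+1 = W k + \sum_(2 ^ k <= j < 2 ^ k.+1) (j%:R `^ (1 + al))^-1 * e j); last first.
    by rewrite /W -big_cat_nat//= ?expn_gt0// leq_exp2l.
  rewrite lerD2l.
  rewrite mulr_sumr !big_nat; apply: ler_sum => j /andP[kj jk].
  have j0 : (0 : R) < j%:R by rewrite ltr0n (leq_trans _ kj)// expn_gt0.
  rewrite ler_wpM2r// lef_pV2 ?posrE ?powR_gt0// ?ltr0n ?expn_gt0//.
  rewrite ge0_ler_powR ?nnegrE ?ler_nat//; first lra.
  by rewrite ltnW.
(* The additional summand w_k E_k carries the induction: it pays for the part E_k of E_(k+1) in the
   next two terms, because 2 w_(k+1) <= w_k. *)
have main k : \sum_(i < k.+1) w i * E i + w k * E k <= 2 * W k.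
  elim: k => [|k ih].
    by rewrite big_ord1 /E /W big_geq// big_geq// !mulr0 addr0.
  rewrite big_ord_recr/=; have := WS k; rewrite EW.
  set D := \sum_(2 ^ k <= j < _) _.
  have D0 : 0 <= D by exact: sumr_ge0.
  have E0 : 0 <= E k by exact: sumr_ge0.
  have := ler_wpM2r E0 (wS k); nra.
have WN k : (k <= r)%N -> W k <= \sum_(1 <= j < n.+1) (j%:R `^ (1 + al))^-1 * e j.
  move=> kr; rewrite (big_cat_nat (n := 2 ^ k) (p := n.+1)) ?expn_gt0//=.
    by rewrite lerDl sumr_ge0// => j _; rewrite mulr_ge0 ?invr_ge0 ?powR_ge0.
  by rewrite (leq_trans _ (leqW rn))// leq_exp2l.
have e1 : e 1%N <= \sum_(1 <= j < n.+1) (j%:R `^ (1 + al))^-1 * e j.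
  rewrite big_ltn// powR1 invr1 mul1r lerDl sumr_ge0// => j _.
  by rewrite mulr_ge0 ?invr_ge0 ?powR_ge0.
case: r rn WN => [|r] rn WN.
  rewrite big_ord0 mulr_ge0 ?sumr_ge0//; first by rewrite addr_ge0 ?mulr_ge0.
  by move=> j _; rewrite mulr_ge0 ?invr_ge0 ?powR_ge0.
rewrite big_ord_recl expr0 mul1r mulrDl mul1r lerD//.
apply: (@le_trans _ _ (4 * K * \sum_(i < r.+1) w i * E i)).
  rewrite [in leRHS]big_ord_recl [E 0]/E big_geq// mulr0 add0r mulr_sumr.
  apply: ler_sum => i _; rewrite /dyadic_average lift0 /w /E powR_inv2n.
  rewrite powRD; last by rewrite pnatr_eq0 -lt0n expn_gt0 implybT.
  rewrite powRr1// invfM le_eqVlt; apply/orP; left; apply/eqP; ring.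
have /(_ r) := main; have := WN r (leqnSn r).
have : 0 <= w r * E r by rewrite mulr_ge0// sumr_ge0.
set S := \sum_(_ < _) _; set Z := \sum_(_ <= _ < _) _ => h1 h2 h3.
rewrite (_ : 8 * K * Z = 4 * K * (2 * Z)); last by ring.
by rewrite ler_wpM2l ?mulr_ge0//; lra.
Qed.

(** Let m be the largest b_k. Summing the recursion up to that index gives m^(2h) <= b_0^(2h) +
    m^(2h-1) U + m^(2h-2) V, where U and V are the sums of the u_k and v_k. Either m <= 3 U, or m^2
    <= 3 V, or each of the last two terms is at most m^(2h) / 3 and m^(2h) <= 3 b_0^(2h). *)
Lemma recursion_bound (h r : nat) (b u v : nat -> R) : (1 < h)%N ->
  (forall k, 0 <= b k) -> (forall k, 0 <= u k) -> (forall k, 0 <= v k) ->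
  (forall k, b k.+1 ^+ h.*2 <=
    b k ^+ h.*2 + b k ^+ (h.*2).-1 * u k + b k ^+ (h.*2).-2 * v k) ->
  b r ^+ h.*2 <= 3 * b 0 ^+ h.*2 + (3 * \sum_(k < r) u k) ^+ h.*2 +
                 (3 * \sum_(k < r) v k) ^+ h.
Proof.
move=> h1 b0 u0 v0 rec.
pose m := \big[Num.max/0]_(k < r.+1) b k.
have bm k : (k <= r)%N -> b k <= m.
  by rewrite -ltnS => kr; exact: (le_bigmax_cond 0 (fun k : 'I_r.+1 => b k) (j := Ordinal kr)).
have m0 : 0 <= m by exact: le_trans (b0 0%N) (bm 0%N _).
set U := \sum_(k < r) u k; set V := \sum_(k < r) v k.
have U0 : 0 <= U by exact: sumr_ge0.
have V0 : 0 <= V by exact: sumr_ge0.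
pose H := b 0%N ^+ h.*2 + m ^+ (h.*2).-1 * U + m ^+ (h.*2).-2 * V.
have bH k : (k <= r)%N -> b k ^+ h.*2 <= H.
  move=> kr; have : b k ^+ h.*2 <= b 0%N ^+ h.*2 +
      m ^+ (h.*2).-1 * (\sum_(i < k) u i) + m ^+ (h.*2).-2 * (\sum_(i < k) v i).
    elim: k kr => [|k ih] kr; first by rewrite !big_ord0 !mulr0 !addr0.
    apply: le_trans (rec k) _; rewrite !big_ord_recr/= !mulrDr.
    have := ih (ltnW kr).
    have : b k ^+ (h.*2).-1 * u k <= m ^+ (h.*2).-1 * u k.
      by rewrite ler_wpM2r// lerXn2r ?nnegrE// bm// ltnW.
    have : b k ^+ (h.*2).-2 * v k <= m ^+ (h.*2).-2 * v k.
      by rewrite ler_wpM2r// lerXn2r ?nnegrE// bm// ltnW.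
    lra.
  move=> /le_trans; apply; rewrite /H.
  have sub (f : nat -> R) : (forall i, 0 <= f i) -> \sum_(i < k) f i <= \sum_(i < r) f i.
    move=> f0; rewrite -!(big_mkord xpredT f) (big_cat_nat (n := k) (p := r))//=.
    by rewrite lerDl sumr_ge0.
  by rewrite lerD ?lerD2l// ler_wpM2l ?exprn_ge0// sub.
have mH : m ^+ h.*2 <= H.
  have [k _ mk] := @eq_bigmax _ _ _ 0 ord0 xpredT (fun k : 'I_r.+1 => b k) isT (fun k _ => b0 k).
  rewrite /m mk.
  by apply: bH; rewrite -ltnS.
have hE : h.*2 = (h.*2).-1.+1 by rewrite prednK// double_gt0; lia.
have hE2 : h.*2 = ((h.*2).-2 + 2)%N by lia.
apply: (le_trans (_ : _ <= m ^+ h.*2)); first by rewrite lerXn2r ?nnegrE// bm.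
have B0 : 0 <= 3 * b 0%N ^+ h.*2 by rewrite mulr_ge0// exprn_ge0.
have U0' : 0 <= (3 * U) ^+ h.*2 by rewrite exprn_ge0// mulr_ge0.
have V0' : 0 <= (3 * V) ^+ h by rewrite exprn_ge0// mulr_ge0.
have [mU|mU] := lerP m (3 * U).
  have : m ^+ h.*2 <= (3 * U) ^+ h.*2 by rewrite lerXn2r ?nnegrE// mulr_ge0.
  by lra.
have [mV|mV] := lerP (m ^+ 2) (3 * V).
  have : m ^+ h.*2 <= (3 * V) ^+ h.
    by rewrite -mul2n exprM lerXn2r ?nnegrE ?exprn_ge0// mulr_ge0.
  by lra.
have : m ^+ (h.*2).-1 * (3 * U) <= m ^+ h.*2.
  by rewrite [in leRHS]hE exprSr ler_wpM2l ?exprn_ge0// ltW.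
have : m ^+ (h.*2).-2 * (3 * V) <= m ^+ h.*2.
  by rewrite [in leRHS]hE2 exprD ler_wpM2l ?exprn_ge0// ltW.
move: mH; rewrite /H; lra.
Qed.

(** In the binomial expansion the terms of degree 1 in x or in y keep their sign, because
    cancellation in them is exploited later. Every other mixed term contains x^2 y^2 times a
    monomial of degree m, which is at most |x|^m + |y|^m in absolute value; the binomial
    coefficients add up to at most 2^(m+4). *)
Lemma expr_add_le (m : nat) (x y : R) :
  (x + y) ^+ m.+4 <= x ^+ m.+4 + y ^+ m.+4 +
    m.+4%:R * (x ^+ m.+3 * y + x * y ^+ m.+3) +
    2 ^+ m.+4 * (`|x| ^+ m.+2 * y ^+ 2 + x ^+ 2 * `|y| ^+ m.+2).
Proof.
set Q := `|x| ^+ m.+2 * y ^+ 2 + x ^+ 2 * `|y| ^+ m.+2.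
have Q0 : 0 <= Q by rewrite addr_ge0// mulr_ge0 ?sqr_ge0 ?exprn_ge0.
have e2 (z : R) k : z ^+ k.+2 = z ^+ 2 * z ^+ k by rewrite -exprD add2n.
have mid (a b : nat) : (a + b)%N = m -> x ^+ a.+2 * y ^+ b.+2 <= Q.
  move=> abm; rewrite (le_trans (ler_norm _))// normrM !normrX.
  have -> : Q = `|x| ^+ 2 * `|y| ^+ 2 * (`|x| ^+ m + `|y| ^+ m).
    by rewrite /Q -(real_normK (num_real x)) -(real_normK (num_real y)) !(e2 _ m); ring.
  rewrite (e2 _ a) (e2 _ b) mulrACA ler_wpM2l//.
  have [xy|/ltW yx] := lerP `|x| `|y|.
    rewrite (@le_trans _ _ (`|y| ^+ a * `|y| ^+ b))// ?ler_wpM2r ?exprn_ge0 ?lerXn2r ?nnegrE//.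
    by rewrite -exprD abm lerDr exprn_ge0.
  rewrite (@le_trans _ _ (`|x| ^+ a * `|x| ^+ b))// ?ler_wpM2l ?exprn_ge0 ?lerXn2r ?nnegrE//.
  by rewrite -exprD abm lerDl exprn_ge0.
rewrite exprDn.
have -> : \sum_(i < m.+4.+1) x ^+ (m.+4 - i) * y ^+ i *+ 'C(m.+4, i) =
  x ^+ m.+4 + m.+4%:R * (x ^+ m.+3 * y) +
  \sum_(2 <= i < m.+3) x ^+ (m.+4 - i) * y ^+ i *+ 'C(m.+4, i) +
  m.+4%:R * (x * y ^+ m.+3) + y ^+ m.+4.
  rewrite -(big_mkord xpredT (fun i => x ^+ (m.+4 - i) * y ^+ i *+ 'C(m.+4, i))).
  rewrite big_nat_recr//= big_nat_recr//= big_ltn// big_ltn//.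
  rewrite !bin0 !bin1 !binn subnn subn0 !subSS subn0.
  rewrite (_ : 'C(m.+4, m.+3) = m.+4); last by rewrite -bin_sub// subSnn bin1.
  rewrite (_ : (m.+1 - m)%N = 1%N); last by lia.
  by rewrite !mulr1n !expr0 !expr1 !mulr1 !mul1r -(mulr_natl (_ * y)) -(mulr_natl (x * _)) !addrA.
have : \sum_(2 <= i < m.+3) x ^+ (m.+4 - i) * y ^+ i *+ 'C(m.+4, i) <= 2 ^+ m.+4 * Q.
  apply: (@le_trans _ _ (\sum_(2 <= i < m.+3) Q *+ 'C(m.+4, i))).
    rewrite !big_nat; apply: ler_sum => i /andP[i2 im]; rewrite lerMn2r; apply/orP; right.
    have := mid (m.+2 - i)%N (i - 2)%N; rewrite (_ : (m.+2 - i).+2 = (m.+4 - i)%N); last by lia.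
    by rewrite (_ : (i - 2).+2 = i); [apply|]; lia.
  rewrite sumrMnr -[Q *+ _]mulr_natl ler_wpM2r// -natrX ler_nat.
  rewrite -[in leqRHS](addn1 1) expnDn.
  rewrite -(big_mkord xpredT (fun i => 'C(m.+4, i) * (1 ^ (m.+4 - i) * 1 ^ i)))%N.
  rewrite (big_cat_nat (n := 2) (p := m.+4.+1))//=.
  rewrite (big_cat_nat (m := 2) (n := m.+3) (p := m.+4.+1))//=; last by lia.
  rewrite (eq_bigr (fun i => 'C(m.+4, i) * (1 ^ (m.+4 - i) * 1 ^ i))%N); first by lia.
  by move=> i _; rewrite !exp1n !muln1.
rewrite [m.+4%:R * (_ + _)]mulrDr; move: (2 ^+ m.+4 * Q) (x ^+ m.+4) (y ^+ m.+4).
move: (m.+4%:R * (x ^+ m.+3 * y)) (m.+4%:R * (x * y ^+ m.+3)) (\sum_(_ <= _ < _) _).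
move=> *; lra.
Qed.

End numeric.

(** Arithmetic of the constants. Here 6 = 2 * 3 comes from the factor 2 in the bound on mu and from
    (a + b + c)^p <= 3^p (a^p + b^p + c^p) for nonnegative terms; 54 = 3 * 2 * 9, 51 = 3 * 17, and 4
    = 3 + 1 collects the two multiples of x^p. *)
Lemma combine_moment_bounds {R : realType} (p h : nat) (t b x U V W mu k c : R) :
  0 <= t -> 0 <= b -> 0 <= x -> 0 <= U -> 0 <= V -> 0 <= mu -> 0 <= k -> 0 <= c ->
  W <= 9 * U ->
  b ^+ p <= 3 * x ^+ p + (3 * (2 * k * (9 * U))) ^+ p + (3 * (c * (17 * V))) ^+ h ->
  mu <= 2 * (t * b + t * (x + W)) ->
  mu ^+ p <= t ^+ p * (6 ^+ p * (4 + (54 * k) ^+ p + (51 * c) ^+ h + 9 ^+ p)) *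
    (x ^+ p + U ^+ p + V ^+ h).
Proof.
move=> t0 b0 x0 U0 V0 mu0 k0 c0 WU hb hmu.
have U9 : 0 <= 9 * U by lra.
have sum3 : (b + x + 9 * U) ^+ p <= 3 ^+ p * (b ^+ p + x ^+ p + (9 * U) ^+ p).
  pose M := Num.max b (Num.max x (9 * U)).
  have bM : b <= M by rewrite le_max lexx.
  have xM : x <= M by rewrite !le_max lexx orbT.
  have UM : 9 * U <= M by rewrite !le_max lexx !orbT.
  have M0 := le_trans b0 bM.
  have bp : 0 <= b ^+ p by exact: exprn_ge0.
  have xp : 0 <= x ^+ p by exact: exprn_ge0.
  have Up : 0 <= (9 * U) ^+ p by exact: exprn_ge0.
  have Mp : M ^+ p <= b ^+ p + x ^+ p + (9 * U) ^+ p.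
    rewrite /M /Num.max; case: ifP => _; last lra.
    by case: ifP => _; lra.
  apply: (@le_trans _ _ ((3 * M) ^+ p)).
    by rewrite lerXn2r ?nnegrE; lra.
  by rewrite exprMn ler_wpM2l// exprn_ge0.
have bxU : 0 <= b + x + 9 * U by lra.
have mule : mu <= t * (2 * (b + x + 9 * U)).
  by apply: le_trans hmu _; rewrite -mulrDr mulrCA ler_wpM2l//; lra.
apply: (@le_trans _ _ ((t * (2 * (b + x + 9 * U))) ^+ p)).
  by rewrite lerXn2r ?nnegrE// mulr_ge0// mulr_ge0.
rewrite exprMn -mulrA ler_wpM2l ?exprn_ge0//.
rewrite (_ : (6 : R) = 2 * 3); last by ring.
rewrite (exprMn p 2 3) (exprMn p 2) -!mulrA ler_wpM2l ?exprn_ge0//.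
apply: (le_trans sum3); rewrite ler_wpM2l ?exprn_ge0//.
have {}hb : b ^+ p <= 3 * x ^+ p + (54 * k) ^+ p * U ^+ p + (51 * c) ^+ h * V ^+ h.
  by rewrite -!exprMn; apply: le_trans hb _; rewrite le_eqVlt; apply/orP; left; apply/eqP;
     congr (_ + _ ^+ _ + _ ^+ _); ring.
have xp : 0 <= x ^+ p by exact: exprn_ge0.
have Up : 0 <= U ^+ p by exact: exprn_ge0.
have Vp : 0 <= V ^+ h by exact: exprn_ge0.
have K1 : 0 <= (54 * k) ^+ p by rewrite exprn_ge0// mulr_ge0.
have K2 : 0 <= (51 * c) ^+ h by rewrite exprn_ge0// mulr_ge0.
have K3 : (0 : R) <= 9 ^+ p by rewrite exprn_ge0.
move: hb xp Up Vp K1 K2 K3; rewrite (exprMn p 9 U).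
move: ((54 * k) ^+ p) ((51 * c) ^+ h) (9 ^+ p) (x ^+ p) (U ^+ p) (V ^+ h) (b ^+ p).
move=> K L M X Y Z B hB X0 Y0 Z0 K0 L0 M0.
have := mulr_ge0 K0 X0; have := mulr_ge0 K0 Z0; have := mulr_ge0 L0 X0.
have := mulr_ge0 L0 Y0; have := mulr_ge0 M0 X0; have := mulr_ge0 M0 Z0.
by rewrite !mulrDl !mulrDr; lra.
Qed.

(** * Doubling the length: moments of partial sums *)

Section moments.
Context {d : measure_display} {Omega : measurableType d} {R : realType}.
Variables (P : probability Omega R) (m : nat).
(** Writing the exponent as [m.+4] encodes p >= 4 and makes p - 1 and p - 2 successors. The
    exponents [q1] and [q2] are conjugate to p and to p / 2. *)
Local Notation p := m.+4.
Local Notation pR := (m.+4%:R : R).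
Local Notation q1 := (m.+4%:R / m.+3%:R : R).
Local Notation q2 := (m.+4%:R / m.+2%:R : R).
Implicit Types (f g Y : Omega -> R) (cls : (Omega -> R) -> Prop).

Lemma pR_gt0 : 0 < pR. Proof. by []. Qed.
Lemma q1_gt0 : 0 < q1. Proof. by rewrite divr_gt0. Qed.
Lemma q2_gt0 : 0 < q2. Proof. by rewrite divr_gt0. Qed.
Lemma q1_conj : pR^-1 + q1^-1 = 1.
Proof. by rewrite invf_div -[X in X + _]mul1r -mulrDl nat1r divff. Qed.

Lemma q2_conj : (pR / 2)^-1 + q2^-1 = 1.
Proof. by rewrite !invf_div -mulrDl -natrD divff. Qed.


(** Evenness of the exponent gives f^p = |f|^p. *)
Lemma Lr_expr {f} : f \in Lfun P pR%:E -> ~~ odd m ->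
  P.-integrable setT (EFin \o (fun x => f x ^+ p)) /\
  \int[P]_x (f x ^+ p) = nrm P pR f ^+ p.
Proof.
move=> fL evm.
have fE x : `|f x| `^ pR = f x ^+ p.
  by rewrite powR_mulrn// -normrX ger0_norm// exprn_even_ge0//= !negbK.
split; first by move: (Lr_integrable P pR_gt0 fL); rewrite (funext fE).
rewrite /Rintegral; under eq_integral do rewrite -fE.
by rewrite (nrm_powR P pR_gt0 fL)/= powR_mulrn ?nrm_ge0.
Qed.

Lemma Lr_mul1 {f g} : f \in Lfun P pR%:E -> g \in Lfun P pR%:E ->
  P.-integrable setT (EFin \o (fun x => f x ^+ m.+3 * g x)).
Proof.
move=> fL gL; have [fL' _] := Lr_pow P m.+3 pR f isT pR_gt0 fL.
have [+ _] := hoelder_Lr P q1_gt0 pR_gt0 (etrans (addrC _ _) q1_conj) fL' gL.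
apply: le_integrable => //.
  apply/measurable_EFinP/measurable_funM; last exact: Lr_measurable gL.
  by apply: measurable_funX; exact: Lr_measurable fL.
by move=> x _; rewrite lee_fin /= !(normrM _ (g x)) !normrX normr_id.
Qed.

Lemma Lr_mul2 {f g} : f \in Lfun P pR%:E -> g \in Lfun P pR%:E ->
  P.-integrable setT (EFin \o (fun x => `|f x| ^+ m.+2 * g x ^+ 2)).
Proof.
move=> fL gL; have [fL' _] := Lr_pow P m.+2 pR f isT pR_gt0 fL.
have [gL' _] := Lr_pow P 2 pR g isT pR_gt0 gL.
have [] := hoelder_Lr P q2_gt0 _ (etrans (addrC _ _) q2_conj) fL' gL'.
  by rewrite divr_gt0.
move=> + _; congr (_.-integrable _ (EFin \o _)); apply/funext => x /=.
by rewrite real_normK ?num_real.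
Qed.

(** Integration of [expr_add_le]; by evenness the integrals of pth powers are pth powers of
    norms. *)
Lemma nrm_add_split {f g} {al be ga de : R} : ~~ odd m ->
  f \in Lfun P pR%:E -> g \in Lfun P pR%:E ->
  `|\int[P]_x (f x ^+ m.+3 * g x)| <= al ->
  `|\int[P]_x (g x ^+ m.+3 * f x)| <= be ->
  `|\int[P]_x (`|f x| ^+ m.+2 * g x ^+ 2)| <= ga ->
  `|\int[P]_x (`|g x| ^+ m.+2 * f x ^+ 2)| <= de ->
  nrm P pR (fun x => f x + g x) ^+ p <=
  nrm P pR f ^+ p + nrm P pR g ^+ p + p%:R * (al + be) + 2 ^+ p * (ga + de).
Proof.
move=> evm fL gL hal hbe hga hde.
have [iF EF] := Lr_expr fL evm.
have [iG EG] := Lr_expr gL evm.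
have p1 : (1 : R) <= pR by rewrite ler1n.
have [iFG EFG] := Lr_expr (LrD P pR f g p1 fL gL) evm.
have i1 := Lr_mul1 fL gL; have i2 := Lr_mul1 gL fL.
have i3 := Lr_mul2 fL gL; have i4 := Lr_mul2 gL fL.
have iD (a b : Omega -> R) : P.-integrable setT (EFin \o a) ->
    P.-integrable setT (EFin \o b) -> P.-integrable setT (EFin \o (fun x => a x + b x)).
  by move=> ia ib; have := integrableD measurableT ia ib.
have iZ (c : R) (a : Omega -> R) : P.-integrable setT (EFin \o a) ->
    P.-integrable setT (EFin \o (fun x => c * a x)).
  by move=> ia; have := integrableZl measurableT c ia.
have iA := iD _ _ iF iG; have i12 := iD _ _ i1 i2; have i34 := iD _ _ i3 i4.
have iB := iZ p%:R _ i12; have iC := iZ (2 ^+ p) _ i34.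
have iAB := iD _ _ iA iB.
rewrite -EFG -EF -EG.
apply: (le_trans (le_Rintegral measurableT iFG (iD _ _ iAB iC) _)).
  move=> x _; apply: le_trans (expr_add_le _ _ _) _.
  by rewrite (mulrC (g x ^+ m.+3)) (mulrC (`|g x| ^+ m.+2)).
rewrite RintegralD// RintegralD// RintegralD// !RintegralZl// !RintegralD//.
rewrite lerD//; first rewrite lerD//.
  by rewrite ler_wpM2l// lerD// (le_trans (ler_norm _)).
by rewrite ler_wpM2l ?exprn_ge0// lerD// (le_trans (ler_norm _)).
Qed.

(* Splitting the odd power into its positive and negative parts costs the
   factor 2. *)
Lemma dual_bound_odd_pow {cls f Y} {c : R} : ~~ odd m -> 0 <= c ->
  f \in Lfun P pR%:E -> Y \in Lfun P pR%:E ->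
  cls (fun x => Num.max (f x) 0 ^+ m.+3) -> cls (fun x => Num.max (- f x) 0 ^+ m.+3) ->
  dual_bound P cls q1 Y c ->
  `|\int[P]_x (f x ^+ m.+3 * Y x)| <= 2 * c * nrm P pR f ^+ m.+3.
Proof.
move=> evm c0 fL YL cpos cneg cY.
have mf := Lr_measurable P fL.
have [fL' fE] := Lr_pow P m.+3 pR f isT pR_gt0 fL.
pose pos x := Num.max (f x) 0 ^+ m.+3; pose neg x := Num.max (- f x) 0 ^+ m.+3.
have mpos : measurable_fun setT pos.
  by apply: measurable_funX; apply: measurable_maxr.
have mneg : measurable_fun setT neg.
  by apply: measurable_funX; apply: measurable_maxr => //; exact: measurable_funN.
have pos0 x : 0 <= pos x by rewrite exprn_ge0// le_max lexx orbT.
have neg0 x : 0 <= neg x by rewrite exprn_ge0// le_max lexx orbT.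
have posle x : `|pos x| <= `| `|f x| ^+ m.+3|.
  rewrite (ger0_norm (pos0 x)) (ger0_norm (exprn_ge0 _ (normr_ge0 _))).
  rewrite lerXn2r ?nnegrE// ?le_max ?lexx ?orbT//.
  by rewrite ge_max ler_norm normr_ge0.
have negle x : `|neg x| <= `| `|f x| ^+ m.+3|.
  rewrite (ger0_norm (neg0 x)) (ger0_norm (exprn_ge0 _ (normr_ge0 _))).
  rewrite lerXn2r ?nnegrE// ?le_max ?lexx ?orbT//.
  by rewrite ge_max -normrN ler_norm normr_ge0.
have [posL posN] := Lr_le P q1 _ _ q1_gt0 mpos posle fL'.
have [negL negN] := Lr_le P q1 _ _ q1_gt0 mneg negle fL'.
have [ipos _] := hoelder_Lr P q1_gt0 pR_gt0 (etrans (addrC _ _) q1_conj) posL YL.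
have [ineg _] := hoelder_Lr P q1_gt0 pR_gt0 (etrans (addrC _ _) q1_conj) negL YL.
have -> : \int[P]_x (f x ^+ m.+3 * Y x) =
    \int[P]_x (pos x * Y x) - \int[P]_x (neg x * Y x).
  rewrite -RintegralB//; apply: eq_Rintegral => x _; rewrite -mulrBl; congr (_ * _).
  rewrite /pos /neg; have [f0|/ltW f0] : 0 <= f x \/ f x < 0.
  - by case: (lerP 0 (f x)); [left|right].
  - by rewrite (max_l f0) (@max_r _ _ (- f x)) ?oppr_le0// expr0n subr0.
  rewrite (max_r f0) max_l ?oppr_ge0// expr0n sub0r.
  by rewrite exprNn -signr_odd /= evm expr1 mulN1r opprK.
rewrite (le_trans (ler_normB _ _))//.
have cposY := cY _ pos0 cpos posL; have cnegY := cY _ neg0 cneg negL.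
rewrite fE in posN negN.
have := ler_wpM2l c0 posN; have := ler_wpM2l c0 negN; rewrite -[pos]/(fun x => pos x).
move: cposY cnegY; rewrite /pos /neg; lra.
Qed.

(** Here |f|^(p-2) is nonnegative and is itself the test function; its L^q2 norm is the
    corresponding power of the L^p norm of f. *)
Lemma dual_bound_even_pow {cls f Y} {c : R} :
  f \in Lfun P pR%:E -> cls (fun x => `|f x| ^+ m.+2) ->
  dual_bound P cls q2 Y c ->
  `|\int[P]_x (`|f x| ^+ m.+2 * Y x)| <= c * nrm P pR f ^+ m.+2.
Proof.
move=> fL cf cY; have [fL' <-] := Lr_pow P m.+2 pR f isT pR_gt0 fL.
by apply: cY => // x; exact: exprn_ge0.
Qed.

End moments.

(** * Monotonicity of adaptedness along the two filtrations *)

Section filtrations.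
Context {d : measure_display} {Omega : measurableType d} {R : realType}.
Variables (T Tinv : Omega -> Omega) (G : set (set Omega)).
Hypothesis TK : cancel T Tinv.
Hypothesis TinvK : cancel Tinv T.
Hypothesis G_sub : sub_sigma_algebra_of G.
Implicit Types A B : Omega -> R.

Local Notation adapted := (adapted Tinv G).

Lemma adaptedD m A B : adapted m A -> adapted m B -> adapted m (fun x => A x + B x).
Proof. by move=> mA mB; exact: measurable_wrtD. Qed.

Lemma adapted_comp m (h : R -> R) A : measurable_fun setT h ->
  adapted m A -> adapted m (fun x => h (A x)).
Proof. by move=> mh mA; exact: (measurable_wrt_comp G G_sub h _ mh mA). Qed.

Lemma adapted_sum m (n : nat) (A : nat -> Omega -> R) :
  (forall j, (j < n)%N -> adapted m (A j)) -> adapted m (fun x => \sum_(j < n) A j x).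
Proof.
elim: n => [|n ih] mA.
  rewrite (_ : (fun x => _) = cst 0); first exact: measurable_wrt_cst.
  by apply/funext => x; rewrite big_ord0.
rewrite (_ : (fun x => _) = fun x => \sum_(j < n) A j x + A n x).
  by apply: adaptedD; [apply: ih => j /ltnW|]; exact: mA.
by apply/funext => x; rewrite big_ord_recr.
Qed.

Lemma adapted_incr m n A : G `<=` preimage_set_system setT T G -> (m <= n)%N ->
  adapted m A -> adapted n A.
Proof.
move=> GT mn; rewrite -(subnKC mn); elim: (n - m)%N => [|k ih]; first by rewrite addn0.
move=> /ih mA B mB; rewrite addnS.
have [C GC CE] := GT _ (mA B mB).
have -> : (fun x => A (iter (m + k).+1 Tinv x)) @^-1` B =
    Tinv @^-1` ((fun x => A (iter (m + k) Tinv x)) @^-1` B).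
  by apply/seteqP; split => x /=; rewrite -iterS iterSr.
rewrite -CE setTI (_ : Tinv @^-1` _ = C)//.
by apply/seteqP; split => x /=; rewrite TinvK.
Qed.

Lemma adapted_decr m n A : preimage_set_system setT T G `<=` G -> (m <= n)%N ->
  adapted n A -> adapted m A.
Proof.
move=> GT mn; rewrite -{1}(subnKC mn); elim: (n - m)%N => [|k ih]; first by rewrite addn0.
rewrite addnS => mA; apply: ih => B mB; apply: GT.
exists ((fun x => A (iter (m + k).+1 Tinv x)) @^-1` B); first exact: mA.
by rewrite setTI; apply/seteqP; split => x /=; rewrite -iterS iterSr TK.
Qed.

End filtrations.

(** * Partial sums of the stationary process and their doubling *)

Section stationary_moments.
Context {d : measure_display} {Omega : measurableType d} {R : realType}.
Context {P : probability Omega R} {T Tinv : Omega -> Omega}.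
Hypothesis mT : measurable_fun [set: Omega] T.
Hypothesis mTinv : measurable_fun [set: Omega] Tinv.
Hypothesis TK : cancel T Tinv.
Hypothesis TinvK : cancel Tinv T.
Hypothesis TP : forall A : set Omega, measurable A -> P (T @^-1` A) = P A.
Context {m : nat} {X0 : Omega -> R}.
Local Notation p := m.+4.
Local Notation pR := (m.+4%:R : R).
Local Notation q1 := (m.+4%:R / m.+3%:R : R).
Local Notation q2 := (m.+4%:R / m.+2%:R : R).
Hypothesis X0L : X0 \in Lfun P pR%:E.
Local Notation S := (partial_sum T Tinv X0).

Lemma partial_sumE n x : S n x = \sum_(j < n) X0 (iter j.+1 T x).
Proof. by rewrite /partial_sum big_add1 /= big_mkord. Qed.

Lemma partial_sumD i j x : S (i + j) x = S i x + S j (iter i T x).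
Proof.
rewrite !partial_sumE big_split_ord; congr (_ + _); apply: eq_bigr => k _.
by rewrite (_ : (rshift i k).+1 = (k.+1 + i)%N) ?iterD//= addSn addnC.
Qed.

Lemma Lr_partial_sum n : S n \in Lfun P pR%:E.
Proof.
elim: n => [|n ih].
  rewrite (_ : S 0 = cst 0); first exact: Lfun_cst.
  by apply/funext => x; rewrite partial_sumE big_ord0.
rewrite (_ : S n.+1 = fun x => S n x + X0 (iter n.+1 T x)).
  by apply: LrD => //; [rewrite ler1n|exact: (Lr_iterT mT TP n.+1 X0L).1].
by apply/funext => x; rewrite !partial_sumE big_ord_recr.
Qed.

Lemma partial_sum_adapted (F0 : set (set Omega)) n : sub_sigma_algebra_of F0 ->
  F0 `<=` preimage_set_system setT T F0 -> measurable_wrt F0 X0 ->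
  adapted Tinv F0 n (S n).
Proof.
move=> F0s F0i mX; rewrite (funext (partial_sumE n)).
apply: (adapted_sum _ _ F0s _ _ (fun j x => X0 (iter j.+1 T x))) => j jn.
apply: (adapted_incr T _ _ TinvK _ _ _ F0i jn).
by have := adapted_iterT T Tinv _ TinvK j.+1 0 X0 mX; rewrite addn0.
Qed.

(** Partial sums start at X_1, so S_n o T^i only involves X_(i+1), X_(i+2), ..., all measurable at
    the index i + 1 of the nonincreasing filtration. *)
Lemma partial_sum_adapted_tail (Fbar0 : set (set Omega)) i n :
  sub_sigma_algebra_of Fbar0 ->
  preimage_set_system setT T Fbar0 `<=` Fbar0 -> measurable_wrt Fbar0 X0 ->
  adapted Tinv Fbar0 i.+1 (fun x => S n (iter i T x)).
Proof.
move=> Fs Fd mX; rewrite -addn1; apply: (adapted_iterT T Tinv _ TinvK i 1 (S n)).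
rewrite (funext (partial_sumE n)).
apply: (adapted_sum _ _ Fs _ _ (fun j x => X0 (iter j.+1 T x))) => j _.
apply: (adapted_decr T _ _ TK _ j.+1 _ Fd) => //.
by have := adapted_iterT T Tinv _ TinvK j.+1 0 X0 mX; rewrite addn0.
Qed.

(** [nrm_add_split] for f = S_n and g = S_n o T^n. Powers of f are adapted at time n and are tested
    against g, a shifted copy of S_n; powers of g are measurable at the index n + 1 of the other
    filtration and are tested against S_n itself. *)
Lemma moment_doubling (F0 Fbar0 : set (set Omega)) n (u1 u2 v1 v2 : R) : ~~ odd m ->
  sub_sigma_algebra_of F0 -> F0 `<=` preimage_set_system setT T F0 ->
  measurable_wrt F0 X0 ->
  sub_sigma_algebra_of Fbar0 -> preimage_set_system setT T Fbar0 `<=` Fbar0 ->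
  measurable_wrt Fbar0 X0 ->
  0 <= u1 -> 0 <= u2 ->
  dual_bound P (adapted Tinv F0 0) q1 (S n) u1 ->
  dual_bound P (adapted Tinv Fbar0 n.+1) q1 (S n) u2 ->
  dual_bound P (adapted Tinv F0 0) q2 (fun x => S n x ^+ 2) v1 ->
  dual_bound P (adapted Tinv Fbar0 n.+1) q2 (fun x => S n x ^+ 2) v2 ->
  nrm P pR (S (n + n)%N) ^+ p <= 2 * nrm P pR (S n) ^+ p +
    2 * p%:R * nrm P pR (S n) ^+ m.+3 * (u1 + u2) +
    2 ^+ p * nrm P pR (S n) ^+ m.+2 * (v1 + v2).
Proof.
move=> evm F0s F0i XF Fs Fd XFb u10 u20 hu1 hu2 hv1 hv2.
have SL := Lr_partial_sum n; have mS := Lr_measurable P SL.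
have [gL gE] := Lr_iterT mT TP n SL.
have hpos : measurable_fun [set: R] (fun y : R => Num.max y 0 ^+ m.+3).
  by apply: measurable_funX; apply: measurable_maxr.
have hneg : measurable_fun [set: R] (fun y : R => Num.max (- y) 0 ^+ m.+3).
  by apply: measurable_funX; apply: measurable_maxr => //; exact: measurable_funN.
have habs : measurable_fun [set: R] (fun y : R => `|y| ^+ m.+2).
  by apply: measurable_funX; exact: normr_measurable.
have Sad := partial_sum_adapted F0 n F0s F0i XF.
have gad := partial_sum_adapted_tail Fbar0 n n Fs Fd XFb.
have mS2 : measurable_fun setT (fun x => S n x ^+ 2) by exact: measurable_funX.
have al := dual_bound_odd_pow P m evm u10 SL gL
  (adapted_comp _ _ F0s n _ _ hpos Sad) (adapted_comp _ _ F0s n _ _ hneg Sad)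
  (dual_bound_iter mT mTinv TK TP n mS hu1).
have be := dual_bound_odd_pow P m evm u20 gL SL
  (adapted_comp _ _ Fs n.+1 _ _ hpos gad) (adapted_comp _ _ Fs n.+1 _ _ hneg gad) hu2.
have ga := dual_bound_even_pow P m SL (adapted_comp _ _ F0s n _ _ habs Sad)
  (dual_bound_iter mT mTinv TK TP n mS2 hv1).
have de := dual_bound_even_pow P m gL (adapted_comp _ _ Fs n.+1 _ _ habs gad) hv2.
have := nrm_add_split P m evm SL gL al be ga de.
rewrite gE (_ : (fun x => S n x + _) = S (n + n)%N); last first.
  by apply/funext => x; rewrite partial_sumD.
move=> /le_trans; apply; rewrite le_eqVlt; apply/orP; left; apply/eqP.
by ring.
Qed.

End stationary_moments.

(** * The maximum over a dyadic block *)

(** For 0 <= c <= a + b the ratio c / (a + b) lies in the unit interval and dominates its qth power;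
    this is added up for c = a and c = b. *)
Lemma powRD_le {R : realType} (a b q : R) : 0 <= a -> 0 <= b -> 1 <= q ->
  a `^ q + b `^ q <= (a + b) `^ q.
Proof.
move=> a0 b0 q1; have q0 : q != 0 by rewrite gt_eqF// (lt_le_trans ltr01).
have [ab0|ab] := eqVneq (a + b) 0.
  have [-> ->] : a = 0 /\ b = 0 by lra.
  by rewrite addr0 powR0// addr0.
have ab_gt0 : 0 < a + b by rewrite lt_neqAle eq_sym ab addr_ge0.
have le c : 0 <= c -> c <= a + b -> c `^ q <= (a + b) `^ q * (c / (a + b)).
  move=> c0 cab; have [->|cn0] := eqVneq c 0; first by rewrite powR0// mul0r mulr0.
  rewrite -{1}(divfK ab c) powRM ?divr_ge0 ?(ltW ab_gt0)// mulrC ler_wpM2l ?powR_ge0//.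
  apply: ge1r_powR => //; rewrite divr_gt0 ?ler_pdivrMr ?mul1r//.
  by rewrite lt_neqAle eq_sym cn0.
apply: le_trans (lerD (le a a0 _) (le b b0 _)) _; rewrite ?lerDl ?lerDr//.
by rewrite -mulrDr -mulrDl divff// mulr1.
Qed.

Section superadditivity.
Context {d : measure_display} {Omega : measurableType d} {R : realType}.
Variables (P : probability Omega R).

(** Hoelder's inequality for two summands against the vector (1, 1) gives the factor 2^(1/p) times
    (||A||_q^q + ||B||_q^q)^(1/q), and A^q + B^q <= (A + B)^q pointwise. *)
Lemma nrm_superadd {p q : R} {A B : Omega -> R} : 0 < p -> 0 < q -> p^-1 + q^-1 = 1 ->
  A \in Lfun P q%:E -> B \in Lfun P q%:E ->
  (forall x, 0 <= A x) -> (forall x, 0 <= B x) ->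
  nrm P q A + nrm P q B <= 2 `^ p^-1 * nrm P q (fun x => A x + B x).
Proof.
move=> p0 q0 pq AL BL A0 B0.
have q1 : 1 <= q by rewrite -invf_le1// -pq lerDr invr_ge0 ltW.
have ABL := LrD P q A B q1 AL BL.
have := hoelder2 (nrm_ge0 P q A) (nrm_ge0 P q B) (ler01 : (0 : R) <= 1) (ler01 : (0 : R) <= 1) q0 p0
  (etrans (addrC _ _) pq).
rewrite !mulr1 !powR1 => /le_trans; apply; rewrite mulrC ler_wpM2l ?powR_ge0//.
rewrite -[leRHS](powRr1 (nrm_ge0 _ _ _)) -(mulfV (lt0r_neq0 q0)) powRrM.
rewrite ge0_ler_powR ?nnegrE ?invr_ge0 ?(ltW q0) ?addr_ge0 ?powR_ge0//.
rewrite -lee_fin EFinD -!nrm_powR//.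
rewrite -ge0_integralD//=; last 2 first.
- exact: measurable_int (Lr_integrable P q0 AL).
- exact: measurable_int (Lr_integrable P q0 BL).
apply: ge0_le_integral => //.
- by move=> x _; rewrite -EFinD lee_fin addr_ge0 ?powR_ge0.
- apply: emeasurable_funD.
    exact: measurable_int (Lr_integrable P q0 AL).
  exact: measurable_int (Lr_integrable P q0 BL).
- exact: measurable_int (Lr_integrable P q0 ABL).
move=> x _; rewrite -EFinD lee_fin !ger0_norm ?addr_ge0//.
exact: powRD_le.
Qed.

End superadditivity.

Lemma Rintegral_sum {d : measure_display} {Omega : measurableType d} {R : realType}
    (P : probability Omega R) n (F : nat -> Omega -> R) :
  (forall j, P.-integrable setT (EFin \o F j)) ->
  P.-integrable setT (EFin \o (fun x => \sum_(j < n) F j x)) /\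
  \int[P]_x (\sum_(j < n) F j x) = \sum_(j < n) \int[P]_x F j x.
Proof.
move=> iF; elim: n => [|n [ih1 ih2]].
  rewrite big_ord0 (_ : (fun x => _) = cst 0).
    by split; [exact: finite_measure_integrable_cst|rewrite Rintegral_cst ?mul0r].
  by apply/funext => x; rewrite big_ord0.
rewrite big_ord_recr/= -ih2 (_ : (fun x => _) = fun x => \sum_(j < n) F j x + F n x).
  by split; [exact: (integrableD measurableT ih1 (iF n))|rewrite RintegralD].
by apply/funext => x; rewrite big_ord_recr.
Qed.

(** * Transforms by monotone adapted weights and the running maximum *)

Section maximal.
Context {d : measure_display} {Omega : measurableType d} {R : realType}.
Context {P : probability Omega R} {T Tinv : Omega -> Omega}.
Hypothesis mT : measurable_fun [set: Omega] T.
Hypothesis mTinv : measurable_fun [set: Omega] Tinv.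
Hypothesis TK : cancel T Tinv.
Hypothesis TinvK : cancel Tinv T.
Hypothesis TP : forall A : set Omega, measurable A -> P (T @^-1` A) = P A.
Context {m : nat} {X0 : Omega -> R}.
Local Notation p := m.+4.
Local Notation pR := (m.+4%:R : R).
Local Notation q1 := (m.+4%:R / m.+3%:R : R).
Hypothesis X0L : X0 \in Lfun P pR%:E.
Local Notation S := (partial_sum T Tinv X0).
Local Notation X j := (fun x => X0 (iter j T x)).

Lemma Lr_process j : X j \in Lfun P pR%:E.
Proof. exact: (Lr_iterT mT TP j X0L).1. Qed.

Lemma integrable_mul_process {A : Omega -> R} j : A \in Lfun P q1%:E ->
  P.-integrable setT (EFin \o (fun x => A x * X j x)).
Proof.
move=> AL; have [] := hoelder_Lr P (q1_gt0 m) (pR_gt0 m)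
  (etrans (addrC _ _) (q1_conj m)) AL (Lr_process j).
by [].
Qed.

Lemma Rintegral_mul_partial_sum {A : Omega -> R} s n : A \in Lfun P q1%:E ->
  \int[P]_x (A x * S n (iter s T x)) =
  \sum_(s <= j < s + n) \int[P]_x (A x * X j.+1 x).
Proof.
move=> AL; elim: n => [|n ih].
  rewrite addn0 big_geq//; under eq_Rintegral do rewrite partial_sumE big_ord0 mulr0.
  by rewrite Rintegral_cst// mul0r.
rewrite addnS big_nat_recr ?leq_addr//= -ih -RintegralD//; last 2 first.
- have [gL _] := Lr_iterT mT TP s (Lr_partial_sum (Tinv:=Tinv) mT TP X0L n).
  by have [] := hoelder_Lr P (q1_gt0 m) (pR_gt0 m) (etrans (addrC _ _) (q1_conj m)) AL gL.
- exact: (integrable_mul_process (s + n).+1 AL).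
apply: eq_Rintegral => x _; rewrite -mulrDr; congr (_ * _).
by rewrite !partial_sumE big_ord_recr/= -iterD addnC.
Qed.

(** The solution of C_(r+1) = 2^(1/p) (C_r + u_r) with C_0 = ||X_0||_p; the factor 2^(1/p) is the
    price of one recombination of two halves. *)
Local Notation chain_bound u r :=
  ((2 `^ pR^-1) ^+ r * (nrm P pR X0 + \sum_(l < r) (2 `^ (- pR^-1)) ^+ l * u l)).

(* Halving the time interval and subtracting from the second half the value
   of [A] at its left end costs one use of the bound [u r]; the L^q norms of
   the two halves recombine by superadditivity. *)
Lemma monotone_transform_bound (F0 : set (set Omega)) (u : nat -> R) r s
    (A : nat -> Omega -> R) :
  sub_sigma_algebra_of F0 -> F0 `<=` preimage_set_system setT T F0 ->
  (forall k, 0 <= u k) ->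
  (forall k, dual_bound P (adapted Tinv F0 0) q1 (S (2 ^ k)%N) (u k)) ->
  (forall j x, (s <= j)%N -> 0 <= A j x) ->
  (forall i j x, (s <= i)%N -> (i <= j)%N -> A i x <= A j x) ->
  (forall j, (s <= j)%N -> adapted Tinv F0 j (A j)) ->
  (forall j, (s <= j)%N -> A j \in Lfun P q1%:E) ->
  `|\sum_(s <= j < s + 2 ^ r) \int[P]_x (A j x * X j.+1 x)| <=
  chain_bound u r * nrm P q1 (A (s + 2 ^ r).-1).
Proof.
move=> F0s F0i u0 hu.
have t0 : 0 <= 2 `^ pR^-1 by exact: powR_ge0.
have th0 : 0 <= 2 `^ (- pR^-1) by exact: powR_ge0.
have t1 : 1 <= 2 `^ pR^-1.
  by rewrite -[leLHS](powRr0 2) ler_powR ?ler1n// invr_ge0.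
have tth : 2 `^ pR^-1 * 2 `^ (- pR^-1) = 1.
  by rewrite powRN divff// gt_eqF// powR_gt0.
have C0 r' : 0 <= chain_bound u r'.
  rewrite mulr_ge0 ?exprn_ge0// addr_ge0 ?nrm_ge0// sumr_ge0// => l _.
  by rewrite mulr_ge0 ?exprn_ge0.
elim: r s A => [|r ih] s A A0 Amon Aad AL.
  rewrite expn0 addn1 big_nat1 expr0 mul1r big_ord0 addr0 /= mulrC.
  have [_] := hoelder_Lr P (q1_gt0 m) (pR_gt0 m) (etrans (addrC _ _) (q1_conj m))
    (AL s (leqnn s)) (Lr_process s.+1).
  by rewrite (Lr_iterT mT TP s.+1 X0L).2.
set N := (2 ^ r)%N; set s' := (s + N)%N; set l := (s' + N).-1.
have N0 : (0 < N)%N by rewrite expn_gt0.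
have ss' : (s <= s')%N by rewrite leq_addr.
have s'l : (s' <= l)%N by rewrite /l; lia.
have sl : (s <= l)%N := leq_trans ss' s'l.
have -> : (s + 2 ^ r.+1)%N = (s' + N)%N by rewrite expnS mul2n -addnn addnA.
(* On the second half B is again nonnegative, nondecreasing and adapted, so the induction hypothesis
   applies to it. The subtracted weight does not depend on j and multiplies a single partial sum of
   length N. *)
pose B j x := A j x - A s' x.
have BL j : (s' <= j)%N -> B j \in Lfun P q1%:E.
  move=> s'j.
  have [||+ _] := Lr_le P q1 (B j) (A j) (q1_gt0 m) _ _ (AL j (leq_trans ss' s'j)).
  - apply: measurable_funB; apply: Lr_measurable (AL _ _) => //.
    exact: leq_trans s'j.
  - move=> x; rewrite !ger0_norm ?A0 ?subr_ge0 ?(leq_trans ss')// ?Amon//.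
    by rewrite gerBl A0.
  by [].
have A_le i j : (s <= i)%N -> (i <= j)%N -> nrm P q1 (A i) <= nrm P q1 (A j).
  move=> si ij.
  have [||_] // := Lr_le P q1 (A i) (A j) (q1_gt0 m) _ _ (AL j (leq_trans si ij)).
  - by apply: Lr_measurable (AL _ _).
  - by move=> x; rewrite !ger0_norm ?A0 ?Amon// (leq_trans si).
rewrite (big_cat_nat (n := s')) ?leq_addr//=.
have -> : \sum_(s' <= j < s' + N) \int[P]_x (A j x * X j.+1 x) =
  \sum_(s' <= j < s' + N) \int[P]_x (B j x * X j.+1 x) +
  \int[P]_x (A s' x * S N (iter s' T x)).
  rewrite Rintegral_mul_partial_sum ?AL// -big_split/= !big_nat.
  apply: eq_bigr => j /andP[s'j _]; rewrite -RintegralD//.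
  - by apply: eq_Rintegral => x _; rewrite /B; ring.
  - exact: (integrable_mul_process j.+1 (BL j s'j)).
  - exact: (integrable_mul_process j.+1 (AL s' ss')).
have h1 := ih s A A0 Amon Aad AL.
have {}ih := ih s' B.
have h2 : `|\sum_(s' <= j < s' + N) \int[P]_x (B j x * X j.+1 x)| <=
    chain_bound u r * nrm P q1 (B l).
  apply: ih => //.
  - by move=> j x s'j; rewrite subr_ge0 Amon.
  - by move=> i j x s'i ij; rewrite lerD2r Amon// (leq_trans ss').
  - move=> j s'j; apply: adaptedD => //; first by apply: Aad; exact: leq_trans s'j.
    apply: (adapted_comp _ _ F0s j -%R) => //.
    by apply: (adapted_incr T _ _ TinvK _ _ _ F0i s'j); exact: Aad.
have h3 : `|\int[P]_x (A s' x * S N (iter s' T x))| <= u r * nrm P q1 (A s').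
  apply: (dual_bound_iter mT mTinv TK TP s' _ (hu r)).
  - exact: Lr_measurable (Lr_partial_sum (Tinv:=Tinv) mT TP X0L _).
  - by move=> x; exact: A0.
  - exact: Aad.
  - exact: AL.
have h4 : nrm P q1 (A s') + nrm P q1 (B l) <= 2 `^ pR^-1 * nrm P q1 (A l).
  have := nrm_superadd P (pR_gt0 m) (q1_gt0 m) (q1_conj m) (AL s' ss') (BL l s'l).
  rewrite (_ : (fun x => A s' x + B l x) = A l); last first.
    by apply/funext => x; rewrite /B addrC subrK.
  by apply => x; rewrite ?subr_ge0 ?A0// Amon.
(* The first half ends at s' - 1; moving up to s' makes the two halves recombine exactly, since
   A_(s') + B_l = A_l. *)
have h5 : nrm P q1 (A s'.-1) <= nrm P q1 (A s').
  by apply: A_le (leq_pred _); rewrite /s' -(prednK N0) addnS leq_addr.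
have h6 : nrm P q1 (A s') <= nrm P q1 (A l) by exact: A_le.
have -> : chain_bound u r.+1 =
    2 `^ pR^-1 * chain_bound u r + 2 `^ pR^-1 * u r.
  rewrite big_ord_recr/= exprS addrA mulrDr mulrA; congr (_ + _).
    by rewrite mulrA.
  rewrite -!mulrA; congr (_ * _); rewrite mulrA -exprMn tth expr1n mul1r.
  by [].
have := C0 r; move: h1 h2 h3; set C := chain_bound u r; rewrite -/s'.
move=> h1 h2 h3 C0r.
apply: (@le_trans _ _ (C * (nrm P q1 (A s') + nrm P q1 (B l)) + u r * nrm P q1 (A l))).
  apply: le_trans (ler_normD _ _) _.
  rewrite mulrDr -addrA lerD//; first by rewrite (le_trans h1)// ler_wpM2l.
  apply: le_trans (ler_normD _ _) _; rewrite lerD// (le_trans h3)//.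
  by rewrite ler_wpM2l.
rewrite [leRHS]mulrDl lerD//.
  by rewrite (mulrC (2 `^ _) C) -(mulrA C) ler_wpM2l.
by rewrite ler_wpM2r ?nrm_ge0// ler_peMl.
Qed.

(** The initial value 0 replaces f_0 and keeps the maximum nonnegative, so that its powers are
    admissible test functions. It bounds the f_j from above only; bounds from below come from the
    process started from -X_0. *)
Fixpoint running_max (f : nat -> Omega -> R) n x :=
  if n is n'.+1 then Num.max (running_max f n' x) (f n x) else 0.
Local Notation M := (running_max S).

Lemma running_max_ge0 n x : 0 <= M n x.
Proof. by elim: n => [//|n ih] /=; rewrite le_max ih. Qed.

Lemma running_max_mono i j x : (i <= j)%N -> M i x <= M j x.
Proof.
move=> ij; rewrite -(subnKC ij); elim: (j - i)%N => [|k ih]; first by rewrite addn0.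
by rewrite addnS /= le_max ih.
Qed.

Lemma running_max_ub j n x : (0 < j)%N -> (j <= n)%N -> S j x <= M n x.
Proof.
case: j => // j _ jn; apply: le_trans (running_max_mono _ _ _ jn).
by rewrite /= le_max lexx orbT.
Qed.

Lemma Lr_running_max n : M n \in Lfun P pR%:E.
Proof.
have p0 := pR_gt0 m : (0 : R) < pR.
elim: n => [|n ih]; first exact: Lfun_cst.
have SL := Lr_partial_sum (Tinv:=Tinv) mT TP X0L n.+1.
have absL f : f \in Lfun P pR%:E -> (fun x : Omega => `|f x|) \in Lfun P pR%:E.
  move=> fL; have mf : measurable_fun setT (fun x => `|f x|).
    by apply: measurableT_comp => //; exact: Lr_measurable fL.
  apply: (Lr_le P pR _ f p0 mf _ fL).1 => x; by rewrite normr_id.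
have MSL : (fun x => `|M n x| + `|S n.+1 x|) \in Lfun P pR%:E.
  by apply: LrD; rewrite ?ler1n//; exact: absL.
apply: (Lr_le P pR _ _ p0 _ _ MSL).1.
  by apply: measurable_maxr; [exact: Lr_measurable ih|exact: Lr_measurable SL].
move=> x; rewrite (ger0_norm (running_max_ge0 n.+1 x)) ger0_norm ?addr_ge0//=.
by rewrite ge_max ler_wpDr ?ler_norm// ler_wpDl ?ler_norm.
Qed.

(** Summation by parts in inductive form: as S_(n+1) = S_n + X_(n+1), the right-hand side grows by 2
    (M_(n+1)^(p-1) - M_n^(p-1)) S_(n+1). This vanishes unless the maximum increases, and then
    M_(n+1) = S_(n+1). *)
Lemma running_max_pow_le n x : M n x ^+ p <=
  2 * (M n x ^+ m.+3 * S n x - \sum_(j < n) M j x ^+ m.+3 * X j.+1 x).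
Proof.
elim: n => [|n ih]; first by rewrite big_ord0 /= !expr0n/= mul0r subr0 mulr0.
have SS : S n.+1 x = S n x + X n.+1 x by rewrite !partial_sumE big_ord_recr.
suff step : M n.+1 x ^+ p <= M n x ^+ p + 2 * (M n.+1 x ^+ m.+3 - M n x ^+ m.+3) * S n.+1 x.
  apply: le_trans step _; rewrite big_ord_recr /=; move: ih; rewrite SS; lra.
have b0 := running_max_ge0 n x; rewrite /=.
set b := M n x in b0 *; set s := S n.+1 x.
have [sb|bs] : s <= b \/ b < s by case: (lerP s b); [left|right].
  by rewrite (max_l sb) subrr mulr0 mul0r addr0.
rewrite (max_r (ltW bs)); have s0 : 0 < s := le_lt_trans b0 bs.
have y0 : 0 <= b ^+ m.+2 by rewrite exprn_ge0.
have bsy : b ^+ m.+2 <= s ^+ m.+2 by rewrite lerXn2r ?nnegrE// ltW.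
rewrite (exprS s m.+3) (exprS b m.+3) (exprS b m.+2) (exprS s m.+2).
set y := b ^+ m.+2 in y0 bsy *; set z := s ^+ m.+2 in bsy *.
(* With y = b^(p-2) and z = s^(p-2), the claim s^p - 2 b^(p-1) s + b^p >= 0 reads s^2 z - 2 b s y +
   b^2 y >= 0; completing the square splits off s^2 (z - y). *)
suff : 0 <= s * (s * (z - y)) + y * (s - b) ^+ 2 by nra.
have zy : 0 <= z - y by rewrite subr_ge0.
by rewrite addr_ge0// ?(mulr_ge0 (ltW s0))// mulr_ge0 ?sqr_ge0// ltW.
Qed.

(** Integrate [running_max_pow_le]: Hoelder's inequality bounds the first term, and
    [monotone_transform_bound] with the weights M_j^(p-1) bounds the sum. *)
Lemma nrm_running_max_le (F0 : set (set Omega)) (u : nat -> R) r :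
  sub_sigma_algebra_of F0 -> F0 `<=` preimage_set_system setT T F0 ->
  measurable_wrt F0 X0 -> (forall k, 0 <= u k) ->
  (forall k, dual_bound P (adapted Tinv F0 0) q1 (S (2 ^ k)%N) (u k)) ->
  nrm P pR (M (2 ^ r)%N) <= 2 * (nrm P pR (S (2 ^ r)%N) + chain_bound u r).
Proof.
move=> F0s F0i XF u0 hu; set N := (2 ^ r)%N.
have N0 : (0 < N)%N by rewrite expn_gt0.
pose A j x := M j x ^+ m.+3.
have AE j : A j = fun x => `|M j x| ^+ m.+3.
  by apply/funext => x; rewrite ger0_norm// running_max_ge0.
have AL j : A j \in Lfun P q1%:E.
  by rewrite AE; exact: (Lr_pow P m.+3 pR (M j) isT (pR_gt0 m) (Lr_running_max j)).1.
have AN j : nrm P q1 (A j) = nrm P pR (M j) ^+ m.+3.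
  by rewrite AE; exact: (Lr_pow P m.+3 pR (M j) isT (pR_gt0 m) (Lr_running_max j)).2.
have Mad j : adapted Tinv F0 j (M j).
  elim: j => [|j ih]; first exact: measurable_wrt_cst.
  have Sad := partial_sum_adapted TinvK F0 j.+1 F0s F0i XF.
  exact: (measurable_wrt_max F0 F0s _ _ (adapted_incr T _ _ TinvK _ _ _ F0i (leqnSn j) ih) Sad).
have hpow : measurable_fun [set: R] (fun y : R => y ^+ m.+3).
  exact: exprn_measurable.
have h1 : `|\sum_(0 <= j < N) \int[P]_x (A j x * X j.+1 x)| <=
    chain_bound u r * nrm P q1 (A N.-1).
  apply: (@monotone_transform_bound F0 u r 0 A F0s F0i u0 hu) => //.
  - by move=> j x _; rewrite exprn_ge0// running_max_ge0.
  - by move=> i j x _ ij; rewrite lerXn2r ?nnegrE ?running_max_ge0// running_max_mono.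
  - by move=> j _; exact: (adapted_comp _ _ F0s j _ _ hpow (Mad j)).
have SL := Lr_partial_sum (Tinv:=Tinv) mT TP X0L N.
have [iAS h2] := hoelder_Lr P (q1_gt0 m) (pR_gt0 m) (etrans (addrC _ _) (q1_conj m)) (AL N) SL.
have [iS ES] := Rintegral_sum P N (fun j x => A j x * X j.+1 x)
  (fun j => integrable_mul_process j.+1 (AL j)).
have iM : P.-integrable setT (EFin \o (fun x => M N x ^+ p)) /\
    \int[P]_x (M N x ^+ p) = nrm P pR (M N) ^+ p.
  have ME x : `|M N x| `^ pR = M N x ^+ p.
    by rewrite powR_mulrn// ger0_norm// running_max_ge0.
  split; first by move: (Lr_integrable P (pR_gt0 m) (Lr_running_max N)); rewrite (funext ME).
  rewrite /Rintegral; under eq_integral do rewrite -ME.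
  rewrite (nrm_powR P (pR_gt0 m) (Lr_running_max N))/=.
  by rewrite powR_mulrn ?nrm_ge0.
have iR : P.-integrable setT (EFin \o (fun x => 2 *
    (A N x * S N x - \sum_(j < N) A j x * X j.+1 x))).
  exact: (integrableZl measurableT 2 (integrableB measurableT iAS iS)).
have := le_Rintegral measurableT iM.1 iR (fun x _ => running_max_pow_le N x).
rewrite iM.2 RintegralZl//; last exact: (integrableB measurableT iAS iS).
rewrite RintegralB// ES.
set mu := nrm P pR (M N); have mu0 : 0 <= mu by exact: nrm_ge0.
have h3 : nrm P q1 (A N.-1) <= mu ^+ m.+3.
  rewrite -(AN N).
  have [||_] // := Lr_le P q1 (A N.-1) (A N) (q1_gt0 m) _ _ (AL N).
  - exact: Lr_measurable (AL _).
  - move=> x; rewrite !ger0_norm ?exprn_ge0 ?running_max_ge0//.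
    by rewrite lerXn2r ?nnegrE ?running_max_ge0// running_max_mono// leq_pred.
rewrite (AN N) -/mu in h2; rewrite big_mkord in h1.
have C0 : 0 <= chain_bound u r.
  rewrite mulr_ge0 ?exprn_ge0 ?powR_ge0// addr_ge0 ?nrm_ge0// sumr_ge0// => l _.
  by rewrite mulr_ge0 ?exprn_ge0 ?powR_ge0.
move: h1 h2; set C := chain_bound u r; set I1 := Rintegral _ _ _; set I2 := \sum_(_ < _) _.
move=> h1 h2 h.
(* Both bounds contain the factor mu^(p-1), which is divided out when mu is nonzero. *)
have [mu00|mu_neq0] := eqVneq mu 0.
  by rewrite mu00 mulr_ge0// addr_ge0 ?nrm_ge0.
have mup : 0 < mu ^+ m.+3 by rewrite exprn_gt0// lt_neqAle eq_sym mu_neq0.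
rewrite -(ler_pM2r mup) -exprS (le_trans h)//.
rewrite -mulrA ler_wpM2l// mulrDl lerD//; first by rewrite (le_trans (ler_norm _))// mulrC.
by rewrite lerNl; apply: lerNnormlW; apply: (le_trans h1); rewrite ler_wpM2l.
Qed.

End maximal.

(** * Summation over dyadic scales *)

Section combination.
Context {d : measure_display} {Omega : measurableType d} {R : realType}.
Context {P : probability Omega R} {T Tinv : Omega -> Omega}.
Hypothesis mT : measurable_fun [set: Omega] T.
Hypothesis mTinv : measurable_fun [set: Omega] Tinv.
Hypothesis TK : cancel T Tinv.
Hypothesis TinvK : cancel Tinv T.
Hypothesis TP : forall A : set Omega, measurable A -> P (T @^-1` A) = P A.
Context {m : nat} {F0 Fbar0 : set (set Omega)}.
Hypothesis m_even : ~~ odd m.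
Hypothesis F0_sub : sub_sigma_algebra_of F0.
Hypothesis F0_incr : F0 `<=` preimage_set_system [set: Omega] T F0.
Hypothesis Fbar0_sub : sub_sigma_algebra_of Fbar0.
Hypothesis Fbar0_decr : preimage_set_system [set: Omega] T Fbar0 `<=` Fbar0.
Local Notation p := m.+4.
Local Notation h := (m./2.+2).
Local Notation pR := (m.+4%:R : R).
Local Notation q1 := (m.+4%:R / m.+3%:R : R).
Local Notation q2 := (m.+4%:R / m.+2%:R : R).
Local Notation th := (2 `^ (- pR^-1) : R).

Lemma p_double : p = h.*2.
Proof. by rewrite !doubleS -{1}(odd_double_half m) (negbTE m_even). Qed.

Lemma dual_bound_dyadic {cls : nat -> (Omega -> R) -> Prop} {Y : nat -> Omega -> R}
    {e : nat -> R} {q K : R} k :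
  0 <= K -> (forall n, 0 <= e n) -> (forall n, measurable_fun setT (Y n)) ->
  (forall i j A, cls (i + j)%N A -> cls i A) ->
  (forall i j A, cls (i + j)%N A -> cls j (fun x => A (iter i Tinv x))) ->
  (forall i j A, (forall x, 0 <= A x) -> A \in Lfun P q%:E ->
    `|\int[P]_x (A x * Y (i + j)%N x)| <=
    K * (`|\int[P]_x (A x * Y i x)| + `|\int[P]_x (A x * Y j (iter i T x))|)) ->
  (forall n, dual_bound P (cls n) q (Y n) (e n)) ->
  dual_bound P (cls (2 ^ k)%N) q (Y (2 ^ k)%N) (dyadic_average K e k).
Proof.
move=> K0 e0 mY clsl clsr sub eY; case: k => [|k]; first exact: eY.
apply: (dual_bound_average mT mTinv TK TP K0 e0 mY clsl clsr sub) => //.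
by rewrite -{1}(expn0 2) ltn_exp2l.
Qed.

Section fixed_process.
Context {X0 : Omega -> R}.
Hypothesis X0L : X0 \in Lfun P pR%:E.
Hypothesis X0F : measurable_wrt F0 X0.
Hypothesis X0Fb : measurable_wrt Fbar0 X0.
Local Notation S := (partial_sum T Tinv X0).
Variables e v : nat -> R.
Hypothesis e_ge0 : forall n, 0 <= e n.
Hypothesis v_ge0 : forall n, 0 <= v n.
Hypothesis eF : forall n, dual_bound P (adapted Tinv F0 0) q1 (S n) (e n).
Hypothesis eB : forall n, dual_bound P (adapted Tinv Fbar0 n.+1) q1 (S n) (e n).
Hypothesis vF : forall n,
  dual_bound P (adapted Tinv F0 0) q2 (fun x => S n x ^+ 2) (v n).
Hypothesis vB : forall n,
  dual_bound P (adapted Tinv Fbar0 n.+1) q2 (fun x => S n x ^+ 2) (v n).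

Let SL n : S n \in Lfun P pR%:E.
Proof. exact: Lr_partial_sum. Qed.

Let mS n : measurable_fun setT (S n).
Proof. exact: Lr_measurable (SL n). Qed.

Let mS2 n : measurable_fun setT (fun x => S n x ^+ 2).
Proof. exact: measurable_funX. Qed.

(** Test classes for the averaging argument. Since F_0 is contained in F_i, composition with T^-i
    preserves F_0-measurability and the forward class is the same at all times; the backward class
    at time n is that of index n + 1, which shrinks as n grows. *)
Let forward_l (i j : nat) (A : Omega -> R) :
  adapted Tinv F0 0 A -> adapted Tinv F0 0 A.
Proof. by []. Qed.

Let forward_r (i j : nat) (A : Omega -> R) :
  adapted Tinv F0 0 A -> adapted Tinv F0 0 (fun x => A (iter i Tinv x)).
Proof. exact: (adapted_incr T _ _ TinvK _ i _ F0_incr). Qed.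

Let backward_l (i j : nat) (A : Omega -> R) :
  adapted Tinv Fbar0 (i + j).+1 A -> adapted Tinv Fbar0 i.+1 A.
Proof. by apply: (adapted_decr T _ _ TK _ _ _ Fbar0_decr); rewrite ltnS leq_addr. Qed.

Let backward_r (i j : nat) (A : Omega -> R) :
  adapted Tinv Fbar0 (i + j).+1 A -> adapted Tinv Fbar0 j.+1 (fun x => A (iter i Tinv x)).
Proof. by rewrite -addnS adapted_shift. Qed.

Let sub1 i j (A : Omega -> R) : (forall x, 0 <= A x) -> A \in Lfun P q1%:E ->
  `|\int[P]_x (A x * S (i + j)%N x)| <=
  1 * (`|\int[P]_x (A x * S i x)| + `|\int[P]_x (A x * S j (iter i T x))|).
Proof.
move=> _ AL; rewrite mul1r.
have [i1 _] := hoelder_Lr P (q1_gt0 m) (pR_gt0 m) (etrans (addrC _ _) (q1_conj m)) AL (SL i).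
have [jL _] := Lr_iterT mT TP i (SL j).
have [i2 _] := hoelder_Lr P (q1_gt0 m) (pR_gt0 m) (etrans (addrC _ _) (q1_conj m)) AL jL.
rewrite (le_trans _ (ler_normD _ _))// -RintegralD//.
under eq_Rintegral do rewrite partial_sumD mulrDr.
by [].
Qed.

Let sqL {f : Omega -> R} : f \in Lfun P pR%:E -> (fun x => f x ^+ 2) \in Lfun P (pR / 2)%:E.
Proof.
move=> fL; rewrite (_ : (fun x => _) = fun x => `|f x| ^+ 2).
  exact: (Lr_pow P 2 pR f isT (pR_gt0 m) fL).1.
by apply/funext => x; rewrite real_normK ?num_real.
Qed.

(** From (a + b)^2 <= 2 a^2 + 2 b^2 and A >= 0. Squares thus enter the dyadic average with K = 2,
    the sums themselves with K = 1. *)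
Let sub2 i j (A : Omega -> R) : (forall x, 0 <= A x) -> A \in Lfun P q2%:E ->
  `|\int[P]_x (A x * S (i + j)%N x ^+ 2)| <=
  2 * (`|\int[P]_x (A x * S i x ^+ 2)| + `|\int[P]_x (A x * S j (iter i T x) ^+ 2)|).
Proof.
move=> A0 AL.
have pR2 : 0 < pR / 2 by rewrite divr_gt0.
have cj : q2^-1 + (pR / 2)^-1 = 1 by rewrite addrC q2_conj.
have sq f (fL : f \in Lfun P pR%:E) := (hoelder_Lr P (q2_gt0 m) pR2 cj AL (sqL fL)).1.
have [jL _] := Lr_iterT mT TP i (SL j).
have i1 := sq _ (SL i); have i2 := sq _ jL; have i3 := sq _ (SL (i + j)).
have int0 (f : Omega -> R) : `|\int[P]_x (A x * f x ^+ 2)| = \int[P]_x (A x * f x ^+ 2).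
  by rewrite ger0_norm// Rintegral_ge0// => x _; rewrite mulr_ge0 ?sqr_ge0.
rewrite (int0 (S (i + j)%N)) (int0 (S i)) (int0 (fun x => S j (iter i T x))).
have i12 := integrableD measurableT i1 i2.
rewrite -RintegralD// -RintegralZl//; apply: le_Rintegral => //.
  exact: (integrableZl measurableT 2 i12).
move=> x _ /=; rewrite partial_sumD -subr_ge0.
rewrite (_ : _ - _ = A x * (S i x - S j (iter i T x)) ^+ 2); last by ring.
by rewrite mulr_ge0 ?sqr_ge0.
Qed.

Let e' := dyadic_average 1 e.
Let v' := dyadic_average 2 v.

Let eF' k : dual_bound P (adapted Tinv F0 0) q1 (S (2 ^ k)%N) (e' k).
Proof.
exact: (dual_bound_dyadic (cls := fun=> adapted Tinv F0 0)
  k ler01 e_ge0 mS forward_l forward_r sub1 eF).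
Qed.

Let eB' k : dual_bound P (adapted Tinv Fbar0 (2 ^ k).+1) q1 (S (2 ^ k)%N) (e' k).
Proof.
exact: (dual_bound_dyadic (cls := fun n => adapted Tinv Fbar0 n.+1)
  k ler01 e_ge0 mS backward_l backward_r sub1 eB).
Qed.

Let vF' k : dual_bound P (adapted Tinv F0 0) q2 (fun x => S (2 ^ k)%N x ^+ 2) (v' k).
Proof.
exact: (dual_bound_dyadic (cls := fun=> adapted Tinv F0 0) (Y := fun n x => S n x ^+ 2)
  k (ler0n _ 2) v_ge0 mS2 forward_l forward_r sub2 vF).
Qed.

Let vB' k : dual_bound P (adapted Tinv Fbar0 (2 ^ k).+1) q2 (fun x => S (2 ^ k)%N x ^+ 2) (v' k).
Proof.
exact: (dual_bound_dyadic (cls := fun n => adapted Tinv Fbar0 n.+1) (Y := fun n x => S n x ^+ 2)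
  k (ler0n _ 2) v_ge0 mS2 backward_l backward_r sub2 vB).
Qed.

Let e'_ge0 k : 0 <= e' k. Proof. exact: dyadic_average_ge0. Qed.
Let v'_ge0 k : 0 <= v' k. Proof. exact: dyadic_average_ge0. Qed.

Variables r n : nat.
Hypothesis n_gt0 : (0 < n)%N.
Hypothesis rn : (2 ^ r <= n)%N.
Let U := \sum_(1 <= k < n.+1) (k%:R `^ (1 + pR^-1))^-1 * e k.
Let V := \sum_(1 <= k < n.+1) (k%:R `^ (1 + 2 / pR))^-1 * v k.

(** [recursion_bound] for b_k = 2^(-k/p) ||S_(2^k)||_p. The dyadic sums are then bounded by
    [sum_dyadic_average], with constants 9 = 1 + 8 * 1 and 17 = 1 + 8 * 2. *)
Lemma normalized_moment_bound :
  (th ^+ r * nrm P pR (S (2 ^ r)%N)) ^+ p <=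
  3 * nrm P pR X0 ^+ p + (3 * (2 * p%:R * (9 * U))) ^+ p +
  (3 * (2 ^+ p * (17 * V))) ^+ h.
Proof.
pose b k := th ^+ k * nrm P pR (S (2 ^ k)%N).
have th0 : 0 <= th by exact: powR_ge0.
(* This cancels the factor 2 in front of the pth power in [moment_doubling]. *)
have thp : th ^+ p = 2^-1.
  by rewrite -powR_mulrn// -powRrM mulNr mulVf// powRN powRr1.
have th2 : th ^+ 2 = 2 `^ (- (2 / pR)).
  by rewrite -powR_mulrn// -powRrM; congr (_ `^ _); ring.
have b0 k : 0 <= b k by rewrite mulr_ge0 ?exprn_ge0 ?nrm_ge0.
have Sb1 : b 0%N = nrm P pR X0.
  rewrite /b expr0 mul1r expn0 -(Lr_iterT mT TP 1 X0L).2; congr nrm.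
  by apply/funext => x; rewrite partial_sumE big_ord1.
have rec k : b k.+1 ^+ p <= b k ^+ p + b k ^+ m.+3 * (2 * p%:R * (th ^+ k * e' k)) +
    b k ^+ m.+2 * (2 ^+ p * ((th ^+ 2) ^+ k * v' k)).
  have := moment_doubling mT mTinv TK TinvK TP X0L F0 Fbar0 (2 ^ k)%N (e' k) (e' k) (v' k) (v' k)
    m_even F0_sub F0_incr X0F Fbar0_sub Fbar0_decr X0Fb (e'_ge0 k) (e'_ge0 k)
    (eF' k) (eB' k) (vF' k) (vB' k).
  rewrite addnn -mul2n -expnS; set a := nrm P pR (S (2 ^ k)%N); set a' := nrm _ _ _ => H.
  have -> : b k.+1 ^+ p = 2^-1 * (th ^+ k) ^+ p * a' ^+ p.
    by rewrite /b (exprS th k) (exprMn _ (th * _)) (exprMn _ th) thp.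
  apply: (@le_trans _ _ (2^-1 * (th ^+ k) ^+ p *
    (2 * a ^+ p + 2 * p%:R * a ^+ m.+3 * (e' k + e' k) +
     2 ^+ p * a ^+ m.+2 * (v' k + v' k)))).
    by rewrite ler_wpM2l// mulr_ge0 ?exprn_ge0.
  rewrite /b -/a !(exprMn _ (th ^+ k)) (exprAC th 2 k).
  rewrite (exprS (th ^+ k) m.+3) (exprS (th ^+ k) m.+2) le_eqVlt; apply/orP; left; apply/eqP.
  by field.
have := recursion_bound h r b (fun k => 2 * p%:R * (th ^+ k * e' k))
  (fun k => 2 ^+ p * ((th ^+ 2) ^+ k * v' k)) isT b0.
rewrite -p_double Sb1 -!mulr_sumr => /(_ _ _ rec) /le_trans; apply.
- by move=> k; rewrite (mulr_ge0 (mulr_ge0 _ _) (mulr_ge0 _ (e'_ge0 k))) ?exprn_ge0.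
- by move=> k; rewrite (mulr_ge0 _ (mulr_ge0 _ (v'_ge0 k))) ?exprn_ge0.
have hU := sum_dyadic_average 1 pR^-1 e r n ler01 (ltW (_ : 0 < pR^-1)) e_ge0 n_gt0 rn.
have hV := sum_dyadic_average 2 (2 / pR) v r n (ler0n _ 2) (ltW (_ : 0 < 2 / pR)) v_ge0 n_gt0 rn.
have sU0 : 0 <= \sum_(k < r) th ^+ k * e' k.
  by apply: sumr_ge0 => k _; rewrite mulr_ge0 ?exprn_ge0.
have sV0 : 0 <= \sum_(k < r) (th ^+ 2) ^+ k * v' k.
  by apply: sumr_ge0 => k _; rewrite mulr_ge0 ?exprn_ge0.
have {}hU : \sum_(k < r) th ^+ k * e' k <= 9 * U.
  by rewrite (_ : 9 = 1 + 8 * 1); [apply: hU; rewrite invr_gt0|ring].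
have {}hV : \sum_(k < r) (th ^+ 2) ^+ k * v' k <= 17 * V.
  by rewrite th2 (_ : 17 = 1 + 8 * 2); [apply: hV; rewrite divr_gt0|ring].
have U0 := le_trans sU0 hU; have V0 := le_trans sV0 hV.
have {}U0 : 0 <= U by lra.
have {}V0 : 0 <= V by lra.
have : 0 <= 2 ^+ p :> R by rewrite exprn_ge0.
move: (2 ^+ p) => c c0.
by rewrite lerD ?lerD2l//; rewrite lerXn2r ?nnegrE ?ler_wpM2l ?mulr_ge0//.
Qed.

Lemma running_max_bound :
  nrm P pR (running_max S (2 ^ r)%N) ^+ p <= (2 ^ r)%:R *
  (6 ^+ p * (4 + (54 * p%:R) ^+ p + (51 * 2 ^+ p) ^+ h + 9 ^+ p)) *
  (nrm P pR X0 ^+ p + U ^+ p + V ^+ h).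
Proof.
have th0 : 0 < th by rewrite powR_gt0.
have hU := sum_dyadic_average 1 pR^-1 e r n ler01 (ltW (_ : 0 < pR^-1)) e_ge0 n_gt0 rn.
have {}hU : \sum_(k < r) th ^+ k * e' k <= 9 * U.
  by rewrite (_ : 9 = 1 + 8 * 1); [apply: hU; rewrite invr_gt0|ring].
have U0 : 0 <= U.
  by apply: sumr_ge0 => k _; rewrite mulr_ge0 ?invr_ge0 ?powR_ge0.
have V0 : 0 <= V.
  by apply: sumr_ge0 => k _; rewrite mulr_ge0 ?invr_ge0 ?powR_ge0.
have hM := nrm_running_max_le mT mTinv TK TinvK TP X0L F0 e' r F0_sub F0_incr X0F e'_ge0 eF'.
have t0 : 0 <= 2 `^ pR^-1 by exact: powR_ge0.
have tp : ((2 `^ pR^-1) ^+ r) ^+ p = (2 ^ r)%:R.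
  by rewrite exprAC -(powR_mulrn p t0) -powRrM mulVf// powRr1// natrX.
have tth : 2 `^ pR^-1 = th^-1 by rewrite powRN invrK.
rewrite -tp.
(* Here t = 2^(r/p), so that t^p = 2^r, and b = 2^(-r/p) ||S_(2^r)||_p, so that t b is the norm of
   S_(2^r). *)
apply: (combine_moment_bounds p h _ (th ^+ r * nrm P pR (S (2 ^ r)%N)) _ _ _
  (\sum_(k < r) th ^+ k * e' k)) => //.
- by rewrite mulr_ge0 ?exprn_ge0 ?nrm_ge0 ?ltW.
- exact: nrm_ge0.
- exact: nrm_ge0.
- exact: normalized_moment_bound.
by rewrite [_ * (th ^+ r * _)]mulrA -exprMn tth mulVf ?gt_eqF// expr1n mul1r -tth.
Qed.

End fixed_process.
End combination.

(** * From dyadic to general length, and from one-sided to absolute maxima *)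

Lemma overlapping_blocks (N n j : nat) :
  (N <= n)%N -> (n < 2 * N)%N -> (N < j)%N -> (j <= n)%N ->
  [/\ (0 < n - N)%N, (n - N <= N)%N, (0 < j - (n - N))%N,
     (j - (n - N) <= N)%N & j = ((n - N) + (j - (n - N)))%N].
Proof. by move=> *; split; lia. Qed.

Lemma measurable_bigmaxr {d : measure_display} {Omega : measurableType d} {R : realType}
    (s : seq nat) (f : nat -> Omega -> R) : (forall j, measurable_fun setT (f j)) ->
  measurable_fun setT (fun x => \big[Num.max/0]_(j <- s) f j x).
Proof.
move=> mf; elim: s => [|j s ih].
  rewrite (_ : (fun x => _) = cst 0); first exact: measurable_cst.
  by apply/funext => x; rewrite big_nil.
rewrite (_ : (fun x => _) = fun x => Num.max (f j x) (\big[Num.max/0]_(j <- s) f j x)).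
  exact: measurable_maxr.
by apply/funext => x; rewrite big_cons.
Qed.

Section general_length.
Context {d : measure_display} {Omega : measurableType d} {R : realType}.
Context {P : probability Omega R} {T Tinv : Omega -> Omega}.
Hypothesis mT : measurable_fun [set: Omega] T.
Hypothesis mTinv : measurable_fun [set: Omega] Tinv.
Hypothesis TK : cancel T Tinv.
Hypothesis TinvK : cancel Tinv T.
Hypothesis TP : forall A : set Omega, measurable A -> P (T @^-1` A) = P A.
Context {m : nat} {F0 Fbar0 : set (set Omega)}.
Hypothesis m_even : ~~ odd m.
Hypothesis F0_sub : sub_sigma_algebra_of F0.
Hypothesis F0_incr : F0 `<=` preimage_set_system [set: Omega] T F0.
Hypothesis Fbar0_sub : sub_sigma_algebra_of Fbar0.
Hypothesis Fbar0_decr : preimage_set_system [set: Omega] T Fbar0 `<=` Fbar0.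
Local Notation p := m.+4.
Local Notation h := (m./2.+2).
Local Notation pR := (m.+4%:R : R).
Local Notation q1 := (m.+4%:R / m.+3%:R : R).
Local Notation q2 := (m.+4%:R / m.+2%:R : R).

Lemma measurable_wrtN (G : set (set Omega)) (f : Omega -> R) :
  sub_sigma_algebra_of G -> measurable_wrt G f -> measurable_wrt G (fun x => - f x).
Proof.
by move=> Gs mf; apply: (measurable_wrt_comp G Gs -%R f _ mf); exact: oppr_measurable.
Qed.

Lemma dual_boundN {cls : (Omega -> R) -> Prop} {Y : Omega -> R} {c : R} :
  Y \in Lfun P pR%:E -> dual_bound P cls q1 Y c ->
  dual_bound P cls q1 (fun x => - Y x) c.
Proof.
move=> YL cY A A0 clsA AL.
have [iAY _] := hoelder_Lr P (q1_gt0 m) (pR_gt0 m) (etrans (addrC _ _) (q1_conj m)) AL YL.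
rewrite (_ : \int[P]_x (A x * - Y x) = - \int[P]_x (A x * Y x)) ?normrN; first exact: cY.
rewrite -mulN1r -RintegralZl//; apply: eq_Rintegral => x _.
by rewrite mulN1r mulrN.
Qed.

Lemma nrmN (f : Omega -> R) : nrm P pR (fun x => - f x) = nrm P pR f.
Proof.
by rewrite /nrm -[in RHS]oppe_Lnorm; congr (fine (Lnorm _ _ _)).
Qed.

(** With N the largest power of 2 not exceeding n, two overlapping blocks of length N cover the
    times up to n. The factor 2^p comes from splitting S_j into two pieces, and 4 from two blocks
    and two signs. *)
Lemma max_partial_sum_bound {X0 : Omega -> R} (e v : nat -> R) n :
  X0 \in Lfun P pR%:E -> measurable_wrt F0 X0 -> measurable_wrt Fbar0 X0 ->
  (forall k, 0 <= e k) -> (forall k, 0 <= v k) ->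
  let S := partial_sum T Tinv X0 in
  (forall k, dual_bound P (adapted Tinv F0 0) q1 (S k) (e k)) ->
  (forall k, dual_bound P (adapted Tinv Fbar0 k.+1) q1 (S k) (e k)) ->
  (forall k, dual_bound P (adapted Tinv F0 0) q2 (fun x => S k x ^+ 2) (v k)) ->
  (forall k, dual_bound P (adapted Tinv Fbar0 k.+1) q2 (fun x => S k x ^+ 2) (v k)) ->
  (0 < n)%N ->
  (\int[P]_x (\big[Num.max/0]_(1 <= j < n.+1) (`|S j x| ^+ p))%:E <=
  (2 ^+ p * 4 * (6 ^+ p * (4 + (54 * p%:R) ^+ p + (51 * 2 ^+ p) ^+ h + 9 ^+ p)) *
   (n%:R * (nrm P pR X0 ^+ p +
    (\sum_(1 <= k < n.+1) (k%:R `^ (1 + pR^-1))^-1 * e k) ^+ p +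
    (\sum_(1 <= k < n.+1) (k%:R `^ (1 + 2 / pR))^-1 * v k) ^+ h)))%:E)%E.
Proof.
move=> XL XF XFb e0 v0 S eF eB vF vB n0.
pose r := trunc_log 2 n; pose N := (2 ^ r)%N.
have /andP[Nn nN] : (2 ^ r <= n < 2 ^ r.+1)%N by exact: trunc_log_bounds.
rewrite expnS -/N in nN.
have SL k : S k \in Lfun P pR%:E by exact: Lr_partial_sum.
pose X0' x := - X0 x; pose S' := partial_sum T Tinv X0'.
have X0'L : X0' \in Lfun P pR%:E.
  apply: (Lr_le P pR _ X0 (pR_gt0 m) _ _ XL).1.
    by apply: measurable_funN; exact: Lr_measurable XL.
  by move=> x; rewrite normrN.
have S'E k : S' k = fun x => - S k x.
  by apply/funext => x; rewrite /S' /S !partial_sumE -sumrN.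
have S'2 k : (fun x => S' k x ^+ 2) = (fun x => S k x ^+ 2).
  by apply/funext => x; rewrite S'E sqrrN.
have bp := running_max_bound mT mTinv TK TinvK TP m_even F0_sub F0_incr Fbar0_sub
  Fbar0_decr XL XF XFb e v e0 v0 eF eB vF vB r n n0 Nn.
have bn : nrm P pR (running_max S' N) ^+ p <= _ :=
  running_max_bound mT mTinv TK TinvK TP m_even F0_sub F0_incr Fbar0_sub
  Fbar0_decr X0'L (measurable_wrtN _ _ F0_sub XF) (measurable_wrtN _ _ Fbar0_sub XFb)
  e v e0 v0 _ _ _ _ r n n0 Nn.
rewrite nrmN in bn.
set K := 6 ^+ p * _ in bp bn *; set Z := _ + _ + _ in bp bn *.
have {}bn : nrm P pR (running_max S' N) ^+ p <= N%:R * K * Z.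
  (* Since S' = -S, the bounds e and v also hold for the process started from -X_0. *)
  apply: bn => k; rewrite -/S' ?S'2// S'E.
  - exact: dual_boundN.
  - exact: dual_boundN.
have K0 : 0 <= K.
  rewrite mulr_ge0 ?exprn_ge0// !addr_ge0// exprn_ge0// mulr_ge0// exprn_ge0//.
have Z0 : 0 <= Z.
  by rewrite /Z !addr_ge0// exprn_ge0 ?nrm_ge0// sumr_ge0// => k _;
     rewrite mulr_ge0// invr_ge0 powR_ge0.
clearbody K Z.
rewrite -/N -/S in bp.
have ML := Lr_running_max (Tinv := Tinv) mT TP XL N.
have M'L := Lr_running_max (Tinv := Tinv) mT TP X0'L N.
have [iM EM] := Lr_expr P m ML m_even.
have [iM' EM'] := Lr_expr P m M'L m_even.
pose G x := running_max S N x ^+ p + running_max S' N x ^+ p.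
have iG : P.-integrable setT (EFin \o G) by exact: (integrableD measurableT iM iM').
have EG : \int[P]_x G x <= 2 * (N%:R * K * Z).
  by rewrite RintegralD// EM EM' mulr_natl mulr2n lerD.
have mG : measurable_fun setT G by apply/measurable_EFinP; exact: measurable_int iG.
pose G' x := G (iter (n - N) T x).
have EG' : \int[P]_x G' x = \int[P]_x G x by exact: Rintegral_iterT.
have M0 := running_max_ge0 (T := T) (Tinv := Tinv) (X0 := X0) N.
have M'0 := running_max_ge0 (T := T) (Tinv := Tinv) (X0 := X0') N.
have G0 x : 0 <= G x by rewrite addr_ge0// exprn_ge0.
have iG' : P.-integrable setT (EFin \o G').
  apply/integrableP; split; first by apply/measurable_EFinP; exact: measurable_iterT.
  under eq_integral do rewrite gee0_abs ?lee_fin ?G0//.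
  rewrite (integral_iterT mT TP (n - N) mG); exact: integrable_lty.
have SG j x : (0 < j)%N -> (j <= N)%N -> `|S j x| ^+ p <= G x.
  move=> j0 jN; have [Sj|/ltW Sj] : 0 <= S j x \/ S j x < 0.
  - by case: (lerP 0 (S j x)); [left|right].
  - rewrite ger0_norm// (le_trans _ (_ : running_max S N x ^+ p <= _))//.
      by rewrite lerXn2r ?nnegrE// running_max_ub.
    by rewrite lerDl exprn_ge0.
  rewrite ler0_norm// (le_trans _ (_ : running_max S' N x ^+ p <= _))//.
    rewrite lerXn2r ?nnegrE ?oppr_ge0//.
    by have := running_max_ub (T := T) (Tinv := Tinv) (X0 := X0') j N x j0 jN; rewrite -/S' S'E.
  by rewrite lerDr exprn_ge0.
have p1 : 1 <= 2 ^+ p :> R by rewrite exprn_ege1// ler1n.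
have Spow j x : (0 < j)%N -> (j <= n)%N -> `|S j x| ^+ p <= 2 ^+ p * (G x + G' x).
  move=> j0 jn; have G'0 : 0 <= G' x by exact: G0.
  have [jN|Nj] := leqP j N.
    apply: (le_trans (SG j x j0 jN)); rewrite -[leLHS]mul1r ler_pM// lerDl//.
  (* For j > N the second block starts at n - N, which does not depend on j; one shifted copy [G']
     of [G] therefore serves all these j. *)
  have [m0 mN jm0 jmN jE] := overlapping_blocks N n j Nn nN Nj jn.
  have := SG (n - N)%N x m0 mN.
  have := SG (j - (n - N))%N (iter (n - N) T x).
  have -> : S j x = S (n - N)%N x + S (j - (n - N))%N (iter (n - N) T x).
    by rewrite {1}jE /S partial_sumD.
  move=> /(_ jm0 jmN); rewrite -/(G' x).
  move: (S (n - N)%N x) (S (j - (n - N))%N _) => a b hb ha.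
  pose M := Num.max `|a| `|b|.
  apply: (@le_trans _ _ ((2 * M) ^+ p)).
    rewrite lerXn2r ?nnegrE//; first by rewrite mulr_ge0// le_max normr_ge0.
    rewrite (le_trans (ler_normD _ _))// mulr_natl mulr2n lerD// /M le_max lexx ?orbT//.
  rewrite exprMn ler_wpM2l ?exprn_ge0//.
  rewrite /M /Num.max; case: ifP => _.
    by rewrite (le_trans hb)// lerDr.
  by rewrite (le_trans ha)// lerDl.
have iR : P.-integrable setT (EFin \o (fun x => 2 ^+ p * (G x + G' x))).
  exact: (integrableZl measurableT (2 ^+ p) (integrableD measurableT iG iG')).
apply: (@le_trans _ _ (\int[P]_x (2 ^+ p * (G x + G' x))%:E)%E).
  apply: ge0_le_integral => //.
  - move=> x _; rewrite lee_fin; elim/big_rec : _ => // j y _ _.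
    by rewrite le_max exprn_ge0.
  - apply/measurable_EFinP/measurable_bigmaxr => j.
    by apply: measurable_funX; apply: measurableT_comp => //; exact: Lr_measurable (SL j).
  - exact: measurable_int iR.
  - move=> x _; rewrite lee_fin big_seq; elim/big_rec : _ => [|j y].
      by rewrite mulr_ge0 ?exprn_ge0// addr_ge0//; exact: G0.
    rewrite mem_index_iota => /andP[j0 jn] IH; rewrite ge_max IH andbT.
    exact: Spow.
rewrite -[leLHS]fineK; last exact: integrable_fin_num iR.
rewrite lee_fin -/(Rintegral P setT (fun x => 2 ^+ p * (G x + G' x))).
rewrite RintegralZl//; last exact: (integrableD measurableT iG iG').
rewrite RintegralD// EG'; clear - EG K0 Z0 Nn.
have NnR : (N%:R : R) <= n%:R by rewrite ler_nat.
have := ler_wpM2r (mulr_ge0 K0 Z0) NnR; rewrite !(mulrA _ K Z) => H.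
have -> : 2 ^+ p * 4 * K * (n%:R * Z) = 2 ^+ p * (4 * (n%:R * K * Z)) by ring.
by rewrite ler_wpM2l ?exprn_ge0//; move: (\int[P]_x G x) EG => I EG; lra.
Qed.

End general_length.

(** * From dual bounds back to norms of conditional expectations *)

Lemma dual_bound_weaken {d : measure_display} {Omega : measurableType d} {R : realType}
    {P : probability Omega R} {cls cls' : (Omega -> R) -> Prop} {q c c' : R} {Y} :
  (forall A, cls' A -> cls A) -> c <= c' ->
  dual_bound P cls q Y c -> dual_bound P cls' q Y c'.
Proof.
move=> sub cc cY A A0 clsA AL; apply: (le_trans (cY A A0 (sub A clsA) AL)).
by rewrite ler_wpM2r// nrm_ge0.
Qed.

Lemma sub_sigma_algebra_shifted {d : measure_display} {Omega : measurableType d}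
    (T Tinv : Omega -> Omega) (G : set (set Omega)) (k : nat) :
  measurable_fun setT T -> sub_sigma_algebra_of G ->
  sub_sigma_algebra_of (shifted_algebra T Tinv G k%:Z).
Proof.
move=> mT [sG mG]; split; first exact: sigma_algebra_preimage.
move=> _ [B GB <-]; by apply: (measurable_iter k T mT) => //; exact: mG.
Qed.

(** e_k is the sum of the forward and the backward constant, so that one sequence bounds both
    classes and stays below the sum of the two norms. *)
Lemma cond_exp_dual_bounds {d : measure_display} {Omega : measurableType d} {R : realType}
    {P : probability Omega R} {T Tinv : Omega -> Omega} {F0 Fbar0 : set (set Omega)}
    (a q : R) (Y : nat -> Omega -> R) :
  measurable_fun setT T -> cancel T Tinv ->
  sub_sigma_algebra_of F0 -> sub_sigma_algebra_of Fbar0 ->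
  0 < a -> 0 < q -> a^-1 + q^-1 = 1 -> (forall k, Y k \in Lfun P a%:E) ->
  exists e : nat -> R, [/\ forall k, 0 <= e k,
    forall k, dual_bound P (adapted Tinv F0 0) q (Y k) (e k),
    forall k, dual_bound P (adapted Tinv Fbar0 k.+1) q (Y k) (e k) &
    forall k, ((e k)%:E <=
      'N[P]_(a%:E)[EFin \o cond_exp P (shifted_algebra T Tinv F0 0%Z) (Y k)] +
      'N[P]_(a%:E)[EFin \o cond_exp P (shifted_algebra T Tinv Fbar0 k.+1%:Z) (Y k)])%E].
Proof.
move=> mT TK F0s Fbs a0 q0 aq YL.
have dual (G : set (set Omega)) j k : sub_sigma_algebra_of G -> exists c, [/\ 0 <= c,
    (c%:E <= 'N[P]_(a%:E)[EFin \o cond_exp P (shifted_algebra T Tinv G j%:Z) (Y k)])%E &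
    dual_bound P (adapted Tinv G j) q (Y k) c].
  move=> Gs; have [c [c0 cN cY]] := dual_bound_cond_exp P _ _ _ _ a0 q0 aq
    (sub_sigma_algebra_shifted T Tinv G j mT Gs) (YL k).
  exists c; split => //; apply: dual_bound_weaken (lexx c) cY => A.
  exact: adapted_shifted_algebra.
have ex k : exists c, [/\ 0 <= c, dual_bound P (adapted Tinv F0 0) q (Y k) c,
    dual_bound P (adapted Tinv Fbar0 k.+1) q (Y k) c &
    (c%:E <= 'N[P]_(a%:E)[EFin \o cond_exp P (shifted_algebra T Tinv F0 0%Z) (Y k)] +
      'N[P]_(a%:E)[EFin \o cond_exp P (shifted_algebra T Tinv Fbar0 k.+1%:Z) (Y k)])%E].
  have [c [c0 cN cY]] := dual F0 0%N k F0s.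
  have [c' [c'0 c'N c'Y]] := dual Fbar0 k.+1 k Fbs.
  exists (c + c'); split; first exact: addr_ge0.
  - by apply: dual_bound_weaken cY => //; rewrite lerDl.
  - by apply: dual_bound_weaken c'Y => //; rewrite lerDr.
  - by rewrite EFinD leeD.
have [e he] := choice ex.
by exists e; split => k; have [] := he k.
Qed.

Lemma lee_expe {R : realType} (x : R) (y : \bar R) k : 0 <= x -> (x%:E <= y)%E ->
  ((x ^+ k)%:E <= y ^+ k)%E.
Proof.
move=> x0 xy; elim: k => [//|k ih]; rewrite exprS EFinM expeS lee_pmul// lee_fin.
by rewrite exprn_ge0.
Qed.

(** Passes from the real constants e_k to the norms in the theorem, which are extended reals. *)
Lemma lee_weighted_sum {R : realType} (w e : nat -> R) (y : nat -> \bar R) n :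
  (forall k, 0 <= w k) -> (forall k, ((e k)%:E <= y k)%E) ->
  ((\sum_(1 <= k < n) w k * e k)%:E <= \sum_(1 <= k < n) (w k)%:E * y k)%E.
Proof.
move=> w0 ey; rewrite -sumEFin; apply: lee_sum => k _.
by rewrite EFinM lee_wpmul2l// lee_fin.
Qed.

Theorem theorem9 (R : realType) (p : nat) (p_ge4 : (4 <= p)%N) (p_even : ~~ odd p) :
  exists C : R,
  forall (d : measure_display) (Omega : measurableType d)
    (P : probability Omega R)
    (T Tinv : Omega -> Omega)
    (mT : measurable_fun [set: Omega] T)
    (mTinv : measurable_fun [set: Omega] Tinv)
    (TK : cancel T Tinv) (TinvK : cancel Tinv T)
    (TP : forall A : set Omega, measurable A -> P (T @^-1` A) = P A)
    (F0 : set (set Omega)) (F0_sub : sub_sigma_algebra_of F0)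
    (F0_incr : F0 `<=` preimage_set_system [set: Omega] T F0)
    (Fbar0 : set (set Omega)) (Fbar0_sub : sub_sigma_algebra_of Fbar0)
    (Fbar0_decr : preimage_set_system [set: Omega] T Fbar0 `<=` Fbar0)
    (X0 : {RV P >-> R})
    (X0_Lp : ('N[P]_(p%:R%:E)[EFin \o X0] < +oo)%E)
    (X0_F0 : measurable_wrt F0 X0)
    (X0_Fbar0 : measurable_wrt Fbar0 X0),
  let X := process T Tinv X0 in
  let S := partial_sum T Tinv X0 in
  let E (k : int) := cond_exp P (shifted_algebra T Tinv F0 k) in
  let Ebar (k : int) := cond_exp P (shifted_algebra T Tinv Fbar0 k) in
  forall n : nat, (0 < n)%N ->
  ('E_P[fun x => \big[Num.max/0%R]_(1 <= j < n.+1) (`|S j x| ^+ p)%R]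
   <= C%:E *
      (n%:R%:E * 'E_P[fun x => (`|X 1 x| ^+ p)%R]
       + n%:R%:E *
         (\sum_(1 <= k < n.+1)
            ((k%:R `^ (1 + p%:R^-1))^-1)%:E *
            ('N[P]_(p%:R%:E)[EFin \o E 0%Z (S k)]
             + 'N[P]_(p%:R%:E)[EFin \o Ebar k.+1%:Z (S k)])) ^+ p
       + n%:R%:E *
         (\sum_(1 <= k < n.+1)
            ((k%:R `^ (1 + 2 / p%:R))^-1)%:E *
            ('N[P]_((p%:R / 2)%:E)[EFin \o E 0%Z (fun x => (S k x ^+ 2)%R)]
             + 'N[P]_((p%:R / 2)%:E)[EFin \o Ebar k.+1%:Z (fun x => (S k x ^+ 2)%R)]))
         ^+ p./2))%E.
Proof.
case: p p_ge4 p_even => [|[|[|[|m]]]]// _ p_even.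
have m_even : ~~ odd m by move: p_even; rewrite /= !negbK.
exists (2 ^+ m.+4 * 4 * (6 ^+ m.+4 * (4 + (54 * m.+4%:R) ^+ m.+4 +
  (51 * 2 ^+ m.+4) ^+ (m./2.+2) + 9 ^+ m.+4))).
move=> d Omega P T Tinv mT mTinv TK TinvK TP F0 F0_sub F0_incr Fbar0 Fbar0_sub
  Fbar0_decr X0 X0_Lp X0_F0 X0_Fbar0 X S E Ebar n n0.
have XL : (X0 : Omega -> R) \in Lfun P (m.+4%:R)%:E.
  by apply/andP; split; apply: mem_set => //=; exact: measurable_funPT.
have SL k : S k \in Lfun P (m.+4%:R)%:E by exact: Lr_partial_sum.
have S2L k : (fun x => S k x ^+ 2) \in Lfun P (m.+4%:R / 2)%:E.
  rewrite (_ : (fun x => _) = fun x => `|S k x| ^+ 2).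
    exact: (Lr_pow P 2 m.+4%:R (S k) isT (pR_gt0 m) (SL k)).1.
  by apply/funext => x; rewrite real_normK ?num_real.
have [e [e0 eF eB eN]] := cond_exp_dual_bounds _ _ S mT TK F0_sub Fbar0_sub
  (pR_gt0 m) (q1_gt0 m) (q1_conj m) SL.
have p2_gt0 : (0 : R) < m.+4%:R / 2 by rewrite divr_gt0.
have [v [v0 vF vB vN]] := cond_exp_dual_bounds _ _ (fun k x => S k x ^+ 2) mT TK F0_sub
  Fbar0_sub p2_gt0 (q2_gt0 m) (q2_conj m) S2L.
rewrite unlock.
apply: le_trans (max_partial_sum_bound mT mTinv TK TinvK TP m_even F0_sub F0_incr
  Fbar0_sub Fbar0_decr e v n XL X0_F0 X0_Fbar0 e0 v0 eF eB vF vB n0) _.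
set C := _ * (6 ^+ _ * _); have C0 : 0 <= C.
  have pow0 (x : R) (k : nat) : 0 <= x -> 0 <= x ^+ k by exact: exprn_ge0.
  have nat0 (k : nat) : (0 : R) <= k%:R by exact: ler0n.
  apply: (mulr_ge0 (mulr_ge0 (pow0 _ _ (nat0 2)) (nat0 4)) (mulr_ge0 (pow0 _ _ (nat0 6)) _)).
  exact: (addr_ge0 (addr_ge0 (addr_ge0 (nat0 4) (pow0 _ _ (mulr_ge0 (nat0 54) (nat0 _))))
    (pow0 _ _ (mulr_ge0 (nat0 51) (pow0 _ _ (nat0 2))))) (pow0 _ _ (nat0 9))).
clearbody C; rewrite EFinM; apply: lee_wpmul2l; first by rewrite lee_fin.
have n0R : (0 <= n%:R%:E :> \bar R)%E by rewrite lee_fin.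
rewrite !mulrDr !EFinD; apply: leeD; first apply: leeD.
- rewrite EFinM lee_wpmul2l//.
  (* By stationarity the norm of X_0 equals that of X_1, whose pth moment appears in the
     statement. *)
  have [XL1 <-] := Lr_iterT mT TP 1 XL.
  rewrite -(powR_mulrn _ (nrm_ge0 _ _ _)) -(nrm_powR P (pR_gt0 m) XL1).
  by rewrite le_eqVlt; apply/orP; left; apply/eqP; apply: eq_integral => x _;
     rewrite powR_mulrn.
- rewrite EFinM lee_wpmul2l// lee_expe//.
    by rewrite sumr_ge0// => k _; rewrite mulr_ge0// invr_ge0 powR_ge0.
  apply: (lee_weighted_sum (fun k => (k%:R `^ (1 + m.+4%:R^-1))^-1)) => // k;
    rewrite ?invr_ge0 ?powR_ge0//.
rewrite EFinM lee_wpmul2l// lee_expe//.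
  by rewrite sumr_ge0// => k _; rewrite mulr_ge0// invr_ge0 powR_ge0.
apply: (lee_weighted_sum (fun k => (k%:R `^ (1 + 2 / m.+4%:R))^-1)) => // k;
  rewrite ?invr_ge0 ?powR_ge0//.
Qed.
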